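(* Let $C$ and $D$ be unital $C^*$-algebras, where $D$ is separable and has approximately inner half-flip, and $C$ is countably saturated and potentially $D$-absorbing. Then: (1) All unital $^*$-homomorphisms of $D$ into $C$ are unitarily conjugate (by unitaries of $C$). (2) Fixing a unital inclusion of $D$ in $C$, the relative commutant $D'\cap C$ is an elementary submodel of $C$. (3) For such an inclusion, $D'\cap C$ is countably saturated.
   Context: A separable unital $C^*$-algebra $D$ has approximately inner half-flip if there is a net of unitaries $u_\lambda$ in the minimal tensor product $D\otimes D$ with $u_\lambda(d\otimes 1)u_\lambda^*\to 1\otimes d$ for all $d\in D$. Logic of $C^*$-algebras: terms are $^*$-polynomials with complex coefficients in noncommuting variables (for unital algebras constant terms are allowed and interpreted as scalar multiples of the unit). Atomic formulas are $\|P\|$ with $P$ a term. Formulas form the smallest set containing the atomic formulas such that $f(\phi_0,\dots,\phi_{n-1})$ is a formula whenever the $\phi_j$ are formulas and $f\colon\mathbb R^n\to\mathbb R$ is continuous, and $\sup_{\|x\|\le 1}\phi$ and $\inf_{\|x\|\le 1}\phi$ are formulas whenever $\phi$ is a formula and $x$ a variable. A formula $\phi(\bar x)$ is interpreted recursively in a $C^*$-algebra $A$ as a real-valued function $\phi^A$ of tuples of $A$. For $A\subseteq B$, $A$ is an elementary submodel of $B$ ($A\prec B$) if $\phi^A(\bar a)=\phi^B(\bar a)$ for all formulas $\phi$ and all tuples $\bar a$ in $A$. $C$ is countably saturated if for every separable subset $A\subseteq C$ and every set $\Sigma$ of formulas with parameters from $A$, in finitely or countably many free variables $\bar x$: if for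 every finite $\Sigma_0\subseteq\Sigma$ and $\varepsilon>0$ there is a tuple $\bar b$ in the unit ball of $C$ with $|\phi^C(\bar b)|<\varepsilon$ for all $\phi\in\Sigma_0$, then there is a tuple $\bar b$ in the unit ball of $C$ with $\phi^C(\bar b)=0$ for all $\phi\in\Sigma$. Potentially $D$-absorbing: for $n\ge 1$, $^*$-polynomials $p_1,\dots,p_n$ with complex coefficients in noncommuting variables $y_1,\dots,y_n$ (constant terms allowed), and $d_1,\dots,d_n$ in the unit ball of $D$, put $r_j=\|p_j(d_1,\dots,d_n)\|$. $C$ is potentially $D$-absorbing if for all such data $$\sup_{\bar x}\inf_{\bar y}\Big(\max_{i,j\le n}\|[x_i,y_j]\|+\max_{j\le n}\big|r_j-\|p_j(\bar y)\|\big|\Big)=0,$$ where $\bar x,\bar y$ range over $n$-tuples in the unit ball of $C$. *)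

(* Defs.v *)
From HB Require Import structures.
From mathcomp Require Import all_boot all_order all_algebra complex.
From mathcomp Require Import all_classical all_reals topology normedtype.

Set Implicit Arguments.
Unset Strict Implicit.
Unset Printing Implicit Defensive.

Import Order.TTheory GRing.Theory Num.Theory.
Import numFieldNormedType.Exports.

Local Open Scope classical_set_scope.
Local Open Scope ring_scope.
Local Open Scope complex_scope.

(* Unital C*-algebras. As for every [algType], 1 != 0. The norm takes its
   values in R: a ring cannot carry the norm of a [normedModType] unless it is
   a [numDomainType]. *)
HB.mixin Record isCstar (R : realType) A & GRing.Algebra R[i] A := {
  star : A -> A ;
  cnorm : A -> R ;
  starK : involutive star ;
  starD : forall x y : A, star (x + y) = star x + star y ;
  starZ : forall (a : R[i]) (x : A), star (a *: x) = Num.conj a *: star x ;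
  starM : forall x y : A, star (x * y) = star y * star x ;
  cnorm_eq0 : forall x : A, cnorm x = 0 -> x = 0 ;
  cnormZ : forall (a : R[i]) (x : A),
    cnorm (a *: x) = complex.Re `|a| * cnorm x ;
  ler_cnormD : forall x y : A, cnorm (x + y) <= cnorm x + cnorm y ;
  ler_cnormM : forall x y : A, cnorm (x * y) <= cnorm x * cnorm y ;
  cnorm_starM : forall x : A, cnorm (star x * x) = cnorm x ^+ 2 ;
  cnorm_complete : forall x : nat -> A,
    (forall eps : R, 0 < eps -> exists N, forall m n,
       (N <= m)%N -> (N <= n)%N -> cnorm (x m - x n) < eps) ->
    exists l : A, forall eps : R, 0 < eps -> exists N, forall n,
       (N <= n)%N -> cnorm (x n - l) < eps
}.

#[short(type="cstarAlgType")]
HB.structure Definition CstarAlgebra (R : realType) :=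
  {A of isCstar R A & GRing.Algebra R[i] A}.

(* The inner product of the library is linear in its first argument. *)
HB.mixin Record isHilbert (R : realType) V & CompleteNormedModule R[i] V := {
  inner : {dot V for (@Num.conj R[i])} ;
  norm_inner : forall x : V, `|x| ^+ 2 = inner x x
}.

#[short(type="hilbertType")]
HB.structure Definition Hilbert (R : realType) :=
  {V of isHilbert R V & CompleteNormedModule R[i] V}.

Section Cstar.
Context {R : realType}.
Implicit Types A B C D E T : cstarAlgType R.

Definition unitary A (u : A) : Prop := star u * u = 1 /\ u * star u = 1.

Definition star_hom A B (f : {lrmorphism A -> B}) : Prop :=
  forall x, f (star x) = star (f x).

Definition norm_closure A (S : set A) : set A :=
  [set x | forall eps : R, 0 < eps -> exists2 y, S y & cnorm (x - y) < eps].

Definition separable_set A (S : set A) : Prop :=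
  exists2 Q : set A, countable Q & Q `<=` S /\ S `<=` norm_closure Q.

Definition cstar_subalgebra A (S : set A) : Prop :=
  [/\ S 1,
      forall (a : R[i]) x y, S x -> S y -> S (a *: x + y),
      forall x y, S x -> S y -> S (x * y),
      forall x, S x -> S (star x)
    & norm_closure S `<=` S].

Definition rel_commutant D C (f : D -> C) : set C :=
  [set c | forall d, f d * c = c * f d].

(** Minimal tensor product *)

Record faithful_rep A (H : hilbertType R) (pi : A -> H -> H) : Prop := {
  rep_linear_op : forall a, linear (pi a) ;
  rep_bounded : forall a, continuous (pi a) ;
  rep_linear : forall b x y xi, pi (b *: x + y) xi = b *: pi x xi + pi y xi ;
  rep1 : pi 1 = id ;
  repM : forall x y, pi (x * y) = pi x \o pi y ;
  rep_star : forall a xi eta, inner (pi a xi) eta = inner xi (pi (star a) eta) ;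
  rep_inj : injective pi
}.

(* A list of pairs stands for the sum of the corresponding elementary tensors:
   [tinner] is the inner product of H (x) K, [tact pi rho x] the action of
   [x] in D (.) E through pi (x) rho, both on the algebraic tensor product of
   H and K. *)
Definition tinner (H K : hilbertType R) (z w : seq (H * K)) : R[i] :=
  \sum_(p <- z) \sum_(q <- w) inner p.1 q.1 * inner p.2 q.2.

Definition tnorm (H K : hilbertType R) (z : seq (H * K)) : R :=
  Num.sqrt (complex.Re (tinner z z)).

Definition tact D E (H K : hilbertType R)
    (pi : D -> H -> H) (rho : E -> K -> K)
    (x : seq (D * E)) (z : seq (H * K)) : seq (H * K) :=
  [seq (pi a.1 p.1, rho a.2 p.2) | a <- x, p <- z].

Definition tsum D E T (i1 : D -> T) (i2 : E -> T) (x : seq (D * E)) : T :=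
  \sum_(a <- x) i1 a.1 * i2 a.2.

(* (T, d |-> d (x) 1, e |-> 1 (x) e) is the spatial tensor product of D and E:
   the norm of T is the operator norm on H (x) K, for faithful representations
   of D and E on H and K (it does not depend on their choice). *)
Definition is_min_tensor D E T
    (i1 : {lrmorphism D -> T}) (i2 : {lrmorphism E -> T}) : Prop :=
  [/\ star_hom i1, star_hom i2,
      forall d e, i1 d * i2 e = i2 e * i1 d,
      norm_closure (range (tsum i1 i2)) = [set: T]
    & exists (H K : hilbertType R) (pi : D -> H -> H) (rho : E -> K -> K),
        [/\ faithful_rep pi, faithful_rep rho
          & forall x : seq (D * E),
              supremums [set tnorm (tact pi rho x z) | z in [set z | tnorm z <= 1]]
                (cnorm (tsum i1 i2 x))]].

Definition directed (I : Type) (le : I -> I -> Prop) : Prop :=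
  [/\ inhabited I,
      forall i, le i i,
      forall i j k, le i j -> le j k -> le i k
    & forall i j, exists k, le i k /\ le j k].

Definition approx_inner_half_flip D : Prop :=
  exists (T : cstarAlgType R)
         (i1 : {lrmorphism D -> T}) (i2 : {lrmorphism D -> T}),
    is_min_tensor i1 i2 /\
    exists (I : Type) (le : I -> I -> Prop) (u : I -> T),
      [/\ directed le,
          forall l, unitary (u l)
        & forall (d : D) (eps : R), 0 < eps ->
            exists l0, forall l, le l0 l ->
              cnorm (u l * i1 d * star (u l) - i2 d) < eps].

(** Logic of C*-algebras *)

Inductive starpoly (X : Type) : Type :=
| PVar of X
| PConst of R[i]
| PAdd of starpoly X & starpoly X
| PMul of starpoly X & starpoly X
| PStar of starpoly X.

Fixpoint peval A X (v : X -> A) (p : starpoly X) : A :=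
  match p with
  | PVar x => v x
  | PConst a => a%:A
  | PAdd p q => peval v p + peval v q
  | PMul p q => peval v p * peval v q
  | PStar p => star (peval v p)
  end.

(* Formulas in the variables x_0, x_1, ... with parameters in P; the quantifiers
   bind the variable with the given index. *)
Inductive formula (P : Type) : Type :=
| FNorm of starpoly (P + nat)
| FConn n (f : 'rV[R]_n -> R) of continuous f & 'I_n -> formula P
| FSup of nat & formula P
| FInf of nat & formula P.

Definition upd X (v : nat -> X) (k : nat) (x : X) : nat -> X :=
  fun i => if i == k then x else v i.

Definition ball1 C (S : set C) : set C := S `&` [set x | cnorm x <= 1].

(* Interpretation in the C*-subalgebra S of C (S = [set: C] for C itself);
   [par] interprets the parameters. *)
Fixpoint interp C (S : set C) P (par : P -> C) (phi : formula P)
    (v : nat -> C) : R :=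
  match phi with
  | FNorm p => cnorm (peval (fun z => match z with
                                      | inl c => par c
                                      | inr i => v i
                                      end) p)
  | FConn n f _ phis => f (\row_i interp S par (phis i) v)
  | FSup k psi => sup [set interp S par psi (upd v k x) | x in ball1 S]
  | FInf k psi => inf [set interp S par psi (upd v k x) | x in ball1 S]
  end.

Definition elementary_submodel C (S : set C) : Prop :=
  cstar_subalgebra S /\
  forall (phi : formula void) (a : nat -> C), (forall i, S (a i)) ->
    interp S (@of_void C) phi a = interp [set: C] (@of_void C) phi a.

(* Countable saturation of the C*-subalgebra S of C. Types in finitely many
   variables are those where only finitely many of x_0, x_1, ... occur freely. *)
Definition countably_saturated C (S : set C) : Prop :=
  forall A : set C, A `<=` S -> separable_set A ->
  forall Sigma : set (formula (set_type A)),
    (forall Sigma0 : set (formula (set_type A)),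
       finite_set Sigma0 -> Sigma0 `<=` Sigma ->
       forall eps : R, 0 < eps ->
       exists b : nat -> C, (forall i, ball1 S (b i)) /\
         forall phi, Sigma0 phi -> `|interp S val phi b| < eps) ->
    exists b : nat -> C, (forall i, ball1 S (b i)) /\
      forall phi, Sigma phi -> interp S val phi b = 0.

Definition tuple_ball C n : set ('I_n -> C) :=
  [set x | forall i, cnorm (x i) <= 1].

Definition potentially_absorbing D C : Prop :=
  forall (n : nat) (p : 'I_n -> starpoly 'I_n) (d : 'I_n -> D),
    (0 < n)%N -> tuple_ball d ->
    let r j := cnorm (peval d (p j)) in
    sup [set inf [set
           \big[Num.max/0]_(i < n) \big[Num.max/0]_(j < n)
              cnorm (x i * y j - y j * x i)
           + \big[Num.max/0]_(j < n) `|r j - cnorm (peval y (p j))|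
         | y in @tuple_ball C n] | x in @tuple_ball C n] = 0.

End Cstar.

(* Main.v *)
Require Import Defs.
From HB Require Import structures.
From mathcomp Require Import all_boot all_order all_algebra complex.
From mathcomp Require Import all_classical all_reals topology normedtype.
From mathcomp Require Import sequences ring lra.

Set Implicit Arguments.
Unset Strict Implicit.
Unset Printing Implicit Defensive.

Import Order.TTheory GRing.Theory Num.Theory.
Import numFieldNormedType.Exports.

Local Open Scope classical_set_scope.
Local Open Scope ring_scope.

(** If f, h : D -> C have commuting ranges, then d (x) e |-> f d * h e is bounded for
the minimal tensor norm: the half-flip approximates the identity of D by completely
positive maps factoring through matrix algebras (D is nuclear). Hence the images of
the half-flip unitaries are approximately unitary in C and approximately conjugate f
to h, and by saturation some unitary v conjugates f to h exactly and commutes with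
any given separable set that commutes with both ranges.

Potential absorption and saturation give such an h whose range commutes with any
prescribed separable set. For (1), choose h commuting with the ranges of both
homomorphisms. For (2) and (3), given a separable B in D' and a separable S in C,
choose h commuting with B and S: conjugation by the resulting v fixes B and maps S
into D'. So in every quantifier of a formula the values taken over the unit ball of
D' and over that of C are the same set, and realizations of types in C can be moved
into D'. *)

(** * Scalars, norms and invertible elements *)

(** The C*-theory is derived from the axioms with real polynomials as the only functional calculus.
    It rests on the spectral radius of self-adjoint elements; square roots and positive parts occur
    only through explicit polynomial approximations.

    The obstacle in bounding d (x) e |-> f d * h e is that, for x of minimal norm at most 1, 1 - x^*
    x is in general not a sum of squares inside the algebraic tensor product. It is close to a
    square x'^* x', but only in the minimal norm, for which f (x) h is not yet known to be
    continuous. The maps [Psi w] are both positive and bounded for that norm. Their bounds depend on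
    w, so they serve only to absorb the error in 1 - x^* x - x'^* x', which is chosen after w;
    positivity then gives the bound 1, uniformly in w.

    The commuting homomorphisms come from a type prescribing the exact norm of every polynomial in a
    generating sequence of D: this makes evaluation at a realization isometric, so that it extends
    to D by continuity. *)

Section Scalars.
Context {R : realType}.
Local Open Scope complex_scope.
Implicit Types (a b : R[i]) (r s t : R).

Definition cabs a : R := complex.Re `|a|.

Lemma cabsE a : `|a| = (cabs a)%:C.
Proof. by rewrite /cabs RRe_real ?normr_real. Qed.

Lemma cabs_ge0 a : 0 <= cabs a.
Proof. by have := normr_ge0 a; rewrite cabsE lecR. Qed.

Lemma cabsM a b : cabs (a * b) = cabs a * cabs b.
Proof. by apply: complexI; rewrite rmorphM /= -!cabsE normrM. Qed.

Lemma cabsX a n : cabs (a ^+ n) = cabs a ^+ n.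
Proof. by apply: complexI; rewrite rmorphXn /= -!cabsE normrX. Qed.

Lemma cabs_real r : cabs r%:C = `|r|.
Proof. by rewrite /cabs normc_def /= expr0n addr0 sqrtr_sqr. Qed.

Lemma cabsC a b : cabs (a - b) = cabs (b - a).
Proof. by apply: complexI; rewrite -!cabsE distrC. Qed.

Lemma cabsN a : cabs (- a) = cabs a.
Proof. by rewrite -sub0r cabsC subr0. Qed.

Lemma cabs0 : cabs 0 = 0.
Proof. by rewrite (cabs_real 0) normr0. Qed.

Lemma cabs1 : cabs 1 = 1.
Proof. by rewrite (cabs_real 1) normr1. Qed.

Lemma cabsV a : cabs a^-1 = (cabs a)^-1.
Proof.
have [->|a0] := eqVneq a 0; first by rewrite !(invr0, cabs0).
have e : cabs a * cabs a^-1 = 1 by rewrite -cabsM divff// cabs1.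
have c0 : cabs a != 0 by apply: contra_eq_neq e => ->; rewrite mul0r eq_sym oner_eq0.
by apply: (mulfI c0); rewrite e divff.
Qed.

Lemma cabs_eq0 a : (cabs a == 0) = (a == 0).
Proof. by rewrite -[RHS]normr_eq0 cabsE -(inj_eq (@complexI R)). Qed.

Lemma conj_real r : Num.conj r%:C = r%:C.
Proof. exact: conjc_real. Qed.

Lemma sqr_cabs a : cabs a ^+ 2 = complex.Re a ^+ 2 + complex.Im a ^+ 2.
Proof. by rewrite /cabs normc_def /= sqr_sqrtr ?addr_ge0 ?sqr_ge0. Qed.

Lemma mulr_conj a : a * Num.conj a = (cabs a ^+ 2)%:C.
Proof. by rewrite rmorphXn /= -cabsE normCK. Qed.

End Scalars.

Section Norm.
Context {R : realType}.
Local Open Scope complex_scope.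
Context {A : cstarAlgType R}.
Implicit Types (x y z : A) (a b : R[i]) (r s t : R).

Lemma cnZ a x : cnorm (a *: x) = cabs a * cnorm x.
Proof. exact: cnormZ. Qed.

Lemma cn0 : cnorm (0 : A) = 0.
Proof. by rewrite -(scale0r (0 : A)) cnZ cabs0 mul0r. Qed.

Lemma cnN x : cnorm (- x) = cnorm x.
Proof. by rewrite -scaleN1r cnZ cabsN cabs1 mul1r. Qed.

Lemma cnB x y : cnorm (x - y) = cnorm (y - x).
Proof. by rewrite -cnN opprB. Qed.

Lemma cn_ge0 x : 0 <= cnorm x.
Proof.
have := ler_cnormD x (- x); rewrite subrr cn0 cnN -mulr2n.
by rewrite pmulrn_lge0.
Qed.

Lemma cn_eq0 x : (cnorm x == 0) = (x == 0).
Proof. by apply/eqP/eqP => [/cnorm_eq0//|->]; rewrite cn0. Qed.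

Lemma cn_gt0 x : (0 < cnorm x) = (x != 0).
Proof. by rewrite lt_neqAle cn_ge0 andbT eq_sym cn_eq0. Qed.

Lemma cn_star x : cnorm (star x) = cnorm x.
Proof.
have H y : cnorm y <= cnorm (star y).
  have [->|y0] := eqVneq y 0; first by rewrite cn0 cn_ge0.
  rewrite -(ler_pM2r (_ : 0 < cnorm y)) ?cn_gt0// -expr2 -cnorm_starM.
  exact: ler_cnormM.
by apply/eqP; rewrite eq_le H -{2}(starK x) H.
Qed.

Lemma star0 : star (0 : A) = 0.
Proof. by apply/eqP; rewrite -cn_eq0 cn_star cn0. Qed.

Lemma starN x : star (- x) = - star x.
Proof. by rewrite -scaleN1r starZ rmorphN rmorph1 scaleN1r. Qed.

Lemma starB x y : star (x - y) = star x - star y.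
Proof. by rewrite starD starN. Qed.

Lemma star1 : star (1 : A) = 1.
Proof.
transitivity (star (star 1 * 1) : A); last by rewrite mulr1 starK.
by rewrite starM starK mulr1.
Qed.

Lemma starX x n : star (x ^+ n) = star x ^+ n.
Proof. by elim: n => [|n IH]; rewrite ?star1// exprS starM IH -exprSr. Qed.

Lemma star_sum I (s : seq I) (F : I -> A) :
  star (\sum_(i <- s) F i) = \sum_(i <- s) star (F i).
Proof. by elim: s => [|i s IH]; rewrite ?big_nil ?star0// !big_cons starD IH. Qed.

Lemma cn1 : cnorm (1 : A) = 1.
Proof.
have := cnorm_starM (1 : A); rewrite star1 mulr1 expr2 => /esym/eqP.
rewrite -[X in _ == X]mulr1 => /eqP/mulfI; apply.
by rewrite cn_eq0 oner_neq0.
Qed.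

Lemma cn_alg a : cnorm (a%:A : A) = cabs a.
Proof. by rewrite cnZ cn1 mulr1. Qed.

Lemma ler_cnD x y r s : cnorm x <= r -> cnorm y <= s -> cnorm (x + y) <= r + s.
Proof. by move=> hx hy; apply: le_trans (ler_cnormD _ _) _; rewrite lerD. Qed.

Lemma ler_cnB x y r s : cnorm x <= r -> cnorm y <= s -> cnorm (x - y) <= r + s.
Proof. by move=> hx hy; apply: ler_cnD; rewrite ?cnN. Qed.

Lemma ler_cnM x y r s : cnorm x <= r -> cnorm y <= s -> cnorm (x * y) <= r * s.
Proof.
by move=> hx hy; apply: le_trans (ler_cnormM _ _) _; rewrite ler_pM ?cn_ge0.
Qed.

Lemma cn_dist x y z r s : cnorm (x - y) <= r -> cnorm (y - z) <= s -> cnorm (x - z) <= r + s.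
Proof. by move=> hx hy; rewrite -(subrKA y); apply: ler_cnD. Qed.

Lemma ler_cnX x n : cnorm (x ^+ n) <= cnorm x ^+ n.
Proof.
elim: n => [|n IH]; first by rewrite !expr0 cn1.
by rewrite !exprS; apply: ler_cnM.
Qed.

Lemma ler_cn_sum I (s : seq I) (F : I -> A) :
  cnorm (\sum_(i <- s) F i) <= \sum_(i <- s) cnorm (F i).
Proof.
elim: s => [|i s IH]; first by rewrite !big_nil cn0.
by rewrite !big_cons; apply: ler_cnD.
Qed.

Lemma cn_sub_eq0 x y : (forall e, 0 < e -> cnorm (x - y) <= e) -> x = y.
Proof.
move=> H; apply/eqP; rewrite -subr_eq0 -cn_eq0 eq_le cn_ge0 andbT.
by apply/ler_addgt0Pl => e e0; rewrite addr0 H.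
Qed.

Lemma star_alg a : star (a%:A : A) = (Num.conj a)%:A.
Proof. by rewrite starZ star1. Qed.

Lemma star_realZ r x : star (r%:C *: x) = r%:C *: star x.
Proof. by rewrite starZ conj_real. Qed.

Lemma cn_realZ r x : cnorm (r%:C *: x) = `|r| * cnorm x.
Proof. by rewrite cnZ cabs_real. Qed.

End Norm.
Lemma expr_small (R : realType) (q e : R) : 0 <= q < 1 -> 0 < e ->
  exists N, forall n, (N <= n)%N -> q ^+ n < e.
Proof.
move=> /andP[q0 q1] e0.
have /cvgrPdist_lt /(_ e e0) [N _ H] : (fun n => q ^+ n) @ \oo --> (0 : R).
  by apply: cvg_expr; rewrite ger0_norm.
exists N => n Nn; have := H n Nn.
by rewrite sub0r normrN ger0_norm ?exprn_ge0.
Qed.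

Section Invertible.
Context {R : realType}.
Local Open Scope complex_scope.
Context {A : cstarAlgType R}.
Implicit Types (x y z : A) (a b : R[i]) (r s t : R).

Definition inverse_of x y := x * y = 1 /\ y * x = 1.
Definition invertible x := exists y, inverse_of x y.

Lemma invertible_lr x y z : x * y = 1 -> z * x = 1 -> invertible x.
Proof.
move=> xy zx; exists y; split=> //.
by have <- : z = y by rewrite -[z]mulr1 -xy mulrA zx mul1r.
Qed.

Lemma invertible_mull x y : x * y = y * x -> invertible (x * y) -> invertible x.
Proof.
move=> c [z [e1 e2]]; apply: (@invertible_lr x (y * z) (z * y)).
  by rewrite mulrA.
by rewrite -mulrA -c.
Qed.

Lemma inverse_ofM x y x' y' :
  inverse_of x x' -> inverse_of y y' -> inverse_of (x * y) (y' * x').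
Proof.
move=> [h1 h2] [h3 h4]; split; first by rewrite mulrA -(mulrA x) h3 mulr1.
by rewrite mulrA -(mulrA y') h2 mulr1.
Qed.

Lemma invertibleM x y : invertible x -> invertible y -> invertible (x * y).
Proof. by move=> [x' hx] [y' hy]; exists (y' * x'); apply: inverse_ofM. Qed.

Lemma inverse_ofZ a x y : a != 0 -> inverse_of x y -> inverse_of (a *: x) (a^-1 *: y).
Proof.
move=> a0 [h1 h2]; split; rewrite -scalerAl -scalerAr ?h1 ?h2 scalerA.
  by rewrite divff ?scale1r.
by rewrite mulVf ?scale1r.
Qed.

Lemma invertibleZ a x : a != 0 -> invertible x -> invertible (a *: x).
Proof. by move=> a0 [y hy]; exists (a^-1 *: y); apply: inverse_ofZ. Qed.

Lemma invertibleN x : invertible x -> invertible (- x).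
Proof. by rewrite -scaleN1r; apply: invertibleZ; rewrite oppr_eq0 oner_eq0. Qed.

Lemma neumann x : cnorm x < 1 ->
  exists y, inverse_of (1 - x) y /\ cnorm y <= (1 - cnorm x)^-1.
Proof.
set q := cnorm x => q1; have q0 : 0 <= q := cn_ge0 x.
have d0 : 0 < 1 - q by rewrite subr_gt0.
pose S n : A := \sum_(k < n) x ^+ k.
have Sl n : (1 - x) * S n = 1 - x ^+ n.
  elim: n => [|n IH]; first by rewrite /S big_ord0 mulr0 expr0 subrr.
  by rewrite /S big_ord_recr mulrDr -/(S n) IH mulrBl mul1r exprS subrKA.
have Sr n : S n * (1 - x) = 1 - x ^+ n.
  elim: n => [|n IH]; first by rewrite /S big_ord0 mul0r expr0 subrr.
  by rewrite /S big_ord_recr mulrDl -/(S n) IH mulrBr mulr1 exprSr subrKA.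
have SD n k : cnorm (S (n + k)%N - S n) <= q ^+ n / (1 - q).
  (* The bound to be proved is not inductive in [k]; the exact value of the geometric sum is. *)
  suff : cnorm (S (n + k)%N - S n) <= q ^+ n * (1 - q ^+ k) / (1 - q).
    move=> /le_trans; apply; rewrite ler_pM2r ?invr_gt0// ler_piMr ?exprn_ge0//.
    by rewrite lerBlDr lerDl exprn_ge0.
  elim: k => [|k IH]; first by rewrite addn0 subrr cn0 expr0 subrr mulr0 mul0r.
  rewrite addnS /S big_ord_recr /= -/(S (n + k)%N) addrAC.
  apply: le_trans (ler_cnD IH (ler_cnX _ _)) _; rewrite -/q.
  rewrite -(ler_pM2r d0) mulrDl !divfK ?gt_eqF// exprD exprS.
  by rewrite le_eqVlt; apply/orP; left; apply/eqP; ring.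
have [l Hl] : exists l : A, forall eps : R, 0 < eps -> exists N, forall n,
       (N <= n)%N -> cnorm (S n - l) < eps.
  apply: cnorm_complete => e e0.
  have [N HN] := expr_small (introT andP (conj q0 q1)) (mulr_gt0 e0 d0).
  exists N.
  have aux n k : (N <= n)%N -> cnorm (S (n + k)%N - S n) < e.
    by move=> /HN h; apply: le_lt_trans (SD _ _) _; rewrite ltr_pdivrMr.
  move=> m n Nm Nn; case: (leqP m n) => [mn|/ltnW nm].
    by rewrite cnB -(subnKC mn) aux.
  by rewrite -(subnKC nm) aux.
have small e : 0 < e -> exists n, cnorm (S n - l) * 2 + q ^+ n <= e.
  move=> e0; have e4 : 0 < e / 4 by rewrite divr_gt0.
  have [N1 H1] := Hl _ e4.
  have [N2 H2] := expr_small (introT andP (conj q0 q1)) e4.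
  exists (maxn N1 N2); have /ltW h1 := H1 _ (leq_maxl N1 N2).
  have /ltW h2 := H2 _ (leq_maxr N1 N2); lra.
have B : cnorm (1 - x) <= 2.
  by apply: ler_cnB; rewrite ?cn1// ltW.
have El : (1 - x) * l = 1.
  apply: cn_sub_eq0 => e /small[n hn]; apply: le_trans hn.
  have -> : (1 - x) * l - 1 = (1 - x) * (l - S n) - x ^+ n.
    by rewrite mulrBr Sl opprB addrCA [RHS]addrC addKr.
  by apply: ler_cnB (ler_cnX _ _); rewrite mulrC; apply: ler_cnM; rewrite // cnB.
have Er : l * (1 - x) = 1.
  apply: cn_sub_eq0 => e /small[n hn]; apply: le_trans hn.
  have -> : l * (1 - x) - 1 = (l - S n) * (1 - x) - x ^+ n.
    by rewrite mulrBl Sr opprB addrCA [RHS]addrC addKr.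
  by apply: ler_cnB (ler_cnX _ _); apply: ler_cnM; rewrite // cnB.
exists l; split=> //.
(* The norm bound follows from [l = 1 + x * l]. *)
rewrite -div1r ler_pdivlMr// mulrBr mulr1 lerBlDr.
have {1}-> : l = 1 + x * l by rewrite -[X in X + _]El mulrBl mul1r subrK.
by apply: ler_cnD; rewrite ?cn1// mulrC ler_cnormM.
Qed.

(** [x - z = x * (1 - y * z)] with [y * z] of norm at most 1/2; the factor 2 is 1 / (1 - 1/2). *)
Lemma inverse_perturb x y z : inverse_of x y -> cnorm z * cnorm y <= 2^-1 ->
  exists y', inverse_of (x - z) y' /\ cnorm y' <= 2 * cnorm y.
Proof.
move=> xy zy.
have h : cnorm (y * z) <= 2^-1.
  by apply: le_trans (ler_cnormM _ _) _; rewrite mulrC.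
have h1 : cnorm (y * z) < 1 by apply: le_lt_trans h _; lra.
have [w [hw nw]] := neumann h1.
exists (w * y); split.
  have -> : x - z = x * (1 - y * z) by rewrite mulrBr mulr1 mulrA xy.1 mul1r.
  exact: inverse_ofM.
apply: ler_cnM => //; apply: le_trans nw _.
rewrite -[leRHS]invrK lef_pV2 ?posrE; lra.
Qed.

Lemma inverse_scalar a x : cnorm x < cabs a ->
  exists y, inverse_of (x - a%:A) y /\ cnorm y <= (cabs a - cnorm x)^-1.
Proof.
move=> xa; have a0 : 0 < cabs a by apply: le_lt_trans xa; apply: cn_ge0.
have an0 : a != 0 by rewrite -cabs_eq0 gt_eqF.
have h : cnorm (a^-1 *: x) < 1.
  by rewrite cnZ cabsV mulrC ltr_pdivrMr ?mul1r.
have [y [hy ny]] := neumann h.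
exists ((- a)^-1 *: y); split.
  have -> : x - a%:A = (- a) *: (1 - a^-1 *: x).
    by rewrite scalerBr scalerA mulNr divff// scaleNr scaleN1r opprK addrC.
  by apply: inverse_ofZ; rewrite ?oppr_eq0.
rewrite cnZ cabsV cabsN.
apply: le_trans (ler_wpM2l _ ny) _; first by rewrite invr_ge0 ltW.
rewrite -invfM mulrC cnZ cabsV mulrBl mul1r mulrAC mulVf ?mul1r//.
by rewrite gt_eqF.
Qed.

Definition spec x : set R[i] := [set a | ~ invertible (x - a%:A)].

Lemma spec_le x a : spec x a -> cabs a <= cnorm x.
Proof.
move=> h; rewrite leNgt; apply/negP => /inverse_scalar[y [hy _]].
by apply: h; exists y.
Qed.

End Invertible.
(** * Spectral radius of self-adjoint elements *)

Section SelfAdjoint.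
Context {R : realType}.
Local Open Scope complex_scope.
Context {A : cstarAlgType R}.
Implicit Types (x y z c : A) (a b l : R[i]) (r s t : R).

Definition sa x := star x = x.

Lemma sqr_cn_sa c : sa c -> cnorm (c * c) = cnorm c ^+ 2.
Proof. by move=> h; rewrite -cnorm_starM h. Qed.

(** Squaring repeatedly with the C*-identity reaches only the exponents 2^k, which is why the
    averaging in [sa_unit_spec] proceeds by doubling. *)
Lemma cn_sa_exp2 c k : sa c -> cnorm (c ^+ (2 ^ k)) = cnorm c ^+ (2 ^ k).
Proof.
move=> h; elim: k => [|k IH]; first by rewrite !expn0 !expr1.
rewrite expnSr !exprM -IH -sqr_cn_sa ?expr2//.
by rewrite /sa starX h.
Qed.

Lemma sqr_cabs_imag a t : cabs (a + (0 +i* t)) ^+ 2 =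
  complex.Re a ^+ 2 + (complex.Im a + t) ^+ 2.
Proof. by rewrite sqr_cabs; case: a => p q /=; rewrite addr0. Qed.

Lemma sqr_cn_sa_imag c t : sa c ->
  cnorm (c + (0 +i* t)%:A) ^+ 2 <= cnorm c ^+ 2 + t ^+ 2.
Proof.
move=> h; rewrite -cnorm_starM starD h star_alg.
have -> : Num.conj (0 +i* t) = - (0 +i* t) :> R[i].
  by apply/eqP; rewrite eq_complex /= oppr0 !eqxx.
have cj x : (0 +i* t)%:A * x = x * (0 +i* t)%:A by rewrite mulr_algl mulr_algr.
rewrite scaleNr mulrDr !mulrBl cj addrA subrK mulr_algl scalerA.
apply: ler_cnB; first by rewrite sqr_cn_sa.
by rewrite cn_alg cabsM -expr2 sqr_cabs /= expr0n add0r.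
Qed.

(** Shift by [it]: the square of |a + it| grows like t^2 + 2 t Im a, while the square of the norm of
    c + it grows only like t^2. *)
Lemma sa_spec_real c a : sa c -> spec c a -> complex.Im a = 0.
Proof.
move=> h sp; apply/eqP/negP => /negP b0.
have H t : complex.Re a ^+ 2 + (complex.Im a + t) ^+ 2 <= cnorm c ^+ 2 + t ^+ 2.
  apply: le_trans (sqr_cn_sa_imag t h).
  rewrite -sqr_cabs_imag ler_sqr ?nnegrE ?cn_ge0 ?cabs_ge0//.
  by apply: spec_le; rewrite /spec /= scalerDl opprD addrACA subrr addr0.
(* This value of t makes the linear term 2 t Im a equal to [cnorm c ^+ 2 + 1], one more than the
   bound allows. *)
have := H ((cnorm c ^+ 2 + 1) / (2 * complex.Im a)).
have e : complex.Im a * ((cnorm c ^+ 2 + 1) / (2 * complex.Im a)) * 2 = cnorm c ^+ 2 + 1.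
  by field.
set t := _ / _ in e *.
have := sqr_ge0 (complex.Re a); have := sqr_ge0 (complex.Im a).
set n2 := cnorm c ^+ 2 in e *.
nra.
Qed.

(* Off the real axis, [c + it] has norm at most [sqrt 2] while [|l + it|^2 = 2 + 2 t Im l],
   so a Neumann series inverts [c - l = (c + it) - (l + it)]. *)
Lemma inverse_off_real c l t : sa c -> cnorm c = 1 -> cabs l = 1 -> t ^+ 2 = 1 ->
    0 < t * complex.Im l ->
  exists y, inverse_of (c - l%:A) y /\ cnorm y <= 2 / (t * complex.Im l).
Proof.
move=> h c1 l1 t1 tl.
have := sqr_cn_sa_imag t h; have := sqr_cabs_imag l t.
set s := cnorm _; set u := cabs _ => hu hs.
have lr : complex.Re l ^+ 2 + complex.Im l ^+ 2 = 1 by rewrite -sqr_cabs l1 expr1n.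
have s0 : 0 <= s := cn_ge0 _. have u0 : 0 <= u := cabs_ge0 _.
rewrite c1 in hs.
have us : s < u by rewrite -ltr_sqr ?nnegrE//; nra.
have [y [hy ny]] := inverse_scalar us.
exists y; split; first by move: hy; rewrite scalerDl opprD addrACA subrr addr0.
apply: le_trans ny _; rewrite -/u -/s -[leRHS]invrK lef_pV2 ?posrE ?subr_gt0//; last first.
  by rewrite invr_gt0 divr_gt0.
rewrite invf_div ler_pdivrMr//.
have u2 : u <= 2 by rewrite -ler_sqr ?nnegrE//; nra.
nra.
Qed.

(** An explicit estimate in place of compactness of the circle: where |Im l| >= b,
    [inverse_off_real] applies; elsewhere l is within 2 b of 1 or -1, and the inverse given there is
    perturbed. *)
Lemma sa_circle_bound c : sa c -> cnorm c = 1 -> invertible (1 - c) ->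
    invertible (1 + c) ->
  exists B, forall l, cabs l = 1 -> exists y, inverse_of (1 - l *: c) y /\ cnorm y <= B.
Proof.
move=> h c1 /invertibleN[y1 hy1] [y2 hy2].
rewrite opprB in hy1.
(* Chosen so that 2 b times the norm of either inverse is at most 1/2, as [inverse_perturb]
   requires. *)
pose b := (4 * (cnorm y1 + cnorm y2 + 1))^-1.
have n1 := cn_ge0 y1; have n2 := cn_ge0 y2.
have b0 : 0 < b by rewrite invr_gt0; nra.
have eb : b * (cnorm y1 + cnorm y2 + 1) = 4^-1.
  by rewrite /b; field; rewrite gt_eqF//; nra.
pose B := 2 / b + 2 * cnorm y1 + 2 * cnorm y2.
have b20 : 0 < 2 / b by rewrite divr_gt0.
suff H l : cabs l = 1 -> exists y, inverse_of (c - l%:A) y /\ cnorm y <= B.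
  exists B => l l1; have [] := H l^-1; first by rewrite cabsV l1 invr1.
  move=> y [hy ny]; exists ((- l)^-1 *: y).
  have l0 : l != 0 by rewrite -cabs_eq0 l1 oner_eq0.
  rewrite cnZ cabsV cabsN l1 invr1 mul1r; split=> //.
  have -> : 1 - l *: c = (- l) *: (c - l^-1%:A).
    by rewrite scalerBr scalerA mulNr divff// !scaleNr scale1r opprK addrC.
  by apply: inverse_ofZ; rewrite ?oppr_eq0.
move=> l1.
have lr : complex.Re l ^+ 2 + complex.Im l ^+ 2 = 1 by rewrite -sqr_cabs l1 expr1n.
have off t : t ^+ 2 = 1 -> b <= t * complex.Im l ->
    exists y, inverse_of (c - l%:A) y /\ cnorm y <= B.
  move=> t1 tb; have [|y [hy ny]] := @inverse_off_real c l t h c1 l1 t1.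
    by apply: lt_le_trans tb.
  exists y; split=> //; apply: le_trans ny _.
  have : 2 / (t * complex.Im l) <= 2 / b.
    by rewrite ler_pM2l// lef_pV2// posrE; apply: lt_le_trans tb.
  rewrite /B; lra.
have [i1|i1] := lerP b (complex.Im l); first by apply: (off 1); rewrite ?expr1n ?mul1r.
have [i2|i2] := lerP b (- complex.Im l).
  by apply: (off (-1)); rewrite ?sqrrN ?expr1n ?mulN1r.
have near (e : R) y : e ^+ 2 = 1 -> 0 <= e * complex.Re l -> inverse_of (c - (e%:C)%:A) y ->
    cnorm y <= cnorm y1 + cnorm y2 ->
    exists y, inverse_of (c - l%:A) y /\ cnorm y <= B.
  move=> e1 el hy ny.
  have hz : cabs (l - e%:C) <= 2 * b.
    rewrite -ler_sqr ?nnegrE ?cabs_ge0//; last by rewrite mulr_ge0// ltW.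
    rewrite sqr_cabs; case: (l) lr i1 i2 el => p q /= lr i1 i2 el; rewrite oppr0 addr0.
    have ep : e * p <= 1 by nra.
    nra.
  have [] := @inverse_perturb _ _ (c - (e%:C)%:A) y ((l - e%:C)%:A) hy.
    rewrite cn_alg; have := cabs_ge0 (l - e%:C); have := cn_ge0 y; nra.
  move=> y' [hy' ny']; exists y'; split.
    by move: hy'; rewrite scalerBl opprB addrA subrK.
  apply: le_trans ny' _; rewrite /B; nra.
have [r0|r0] := lerP 0 (complex.Re l).
  apply: (near 1 y1); rewrite ?expr1n ?mul1r//.
    by rewrite rmorph1 scale1r.
  by rewrite lerDl.
apply: (near (-1) y2); rewrite ?sqrrN ?expr1n ?mulN1r ?oppr_ge0 ?(ltW r0)//.
  by rewrite rmorphN rmorph1 scaleN1r opprK addrC.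
by rewrite lerDr.
Qed.

(** Partial fractions: 2 / (1 - x^2) = 1 / (1 - x) + 1 / (1 + x). Being an average, the new inverse
    inherits any common bound on differences. *)
Lemma inverse_of_sqr x y1 y2 : inverse_of (1 - x) y1 -> inverse_of (1 + x) y2 ->
  inverse_of (1 - x * x) (2^-1%:C *: (y1 + y2)).
Proof.
move=> [h1 h2] [h3 h4].
have e1 : 1 - x * x = (1 - x) * (1 + x).
  by rewrite mulrDr mulr1 mulrBl mul1r addrA subrK.
have e2 : 1 - x * x = (1 + x) * (1 - x).
  by rewrite mulrBr mulr1 mulrDl mul1r opprD addrA addrK.
have two : 2^-1%:C *: ((1 + x) + (1 - x)) = 1.
  rewrite addrCA addrK -mulr2n -(scaler_nat 2 (1 : A)) scalerA -(rmorph_nat (real_complex R)).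
  by rewrite -rmorphM /= mulVf ?pnatr_eq0// scale1r.
split.
  rewrite -scalerAr mulrDr {1}e2 -mulrA h1 mulr1 e1 -mulrA h3 mulr1; exact: two.
rewrite -scalerAl mulrDl {1}e1 mulrA h2 mul1r e2 mulrA h4 mul1r; exact: two.
Qed.

(* Rickart's argument. If both were invertible, the resolvent of [c] would be
   bounded on the unit circle, hence uniformly Lipschitz along radii near it.
   [(1 - (l c)^(2^k))^-1] is an average of such resolvents, so it satisfies the
   same Lipschitz bound for all [k]; as it tends to 1 inside the disc, it is close
   to 1 on the circle too, which forces [c^(2^k)] to be small. *)
Lemma sa_unit_spec c : sa c -> cnorm c = 1 ->
  ~ (invertible (1 - c) /\ invertible (1 + c)).
Proof.
move=> h c1 [i1 i2].
have [B HB] := sa_circle_bound h c1 i1 i2.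
have B0 : 0 <= B.
  have [y [_]] := HB 1 (@cabs1 R); apply: le_trans; exact: cn_ge0.
(* Small enough that d B <= 1/2, for the perturbation, and 2 d B^2 <= 1/8, for the Lipschitz bound
   at k = 0. *)
pose d : R := (16 * (B ^+ 2 + B + 1))^-1.
have D0 : 0 < B ^+ 2 + B + 1 by have := sqr_ge0 B; lra.
have d0 : 0 < d by rewrite invr_gt0; lra.
have d1 : d * (16 * (B ^+ 2 + B + 1)) = 1 by rewrite mulVf ?gt_eqF//; lra.
have dd : d < 1 by nra.
pose s := 1 - d.
have s0 : 0 <= s < 1 by rewrite /s; apply/andP; split; lra.
have P k : forall l, cabs l = 1 -> exists Y Y',
    [/\ inverse_of (1 - (l *: c) ^+ (2 ^ k)) Y,
        inverse_of (1 - ((s%:C * l) *: c) ^+ (2 ^ k)) Y'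
      & cnorm (Y - Y') <= 8^-1].
  elim: k => [|k IH] l l1.
    have [y [hy ny]] := HB l l1.
    have hz : cnorm ((- d)%:C *: (l *: c)) = d.
      by rewrite cn_realZ cnZ l1 c1 !mulr1 normrN gtr0_norm.
    have [] := @inverse_perturb _ _ _ y ((- d)%:C *: (l *: c)) hy.
      rewrite hz; have := cn_ge0 y; nra.
    have -> : 1 - l *: c - (- d)%:C *: (l *: c) = 1 - (s%:C * l) *: c.
      rewrite -addrA -opprD -{1}[l *: c]scale1r -scalerDl scalerA.
      by rewrite -(rmorph1 (real_complex R)) -rmorphD.
    move=> y' [hy' ny']; exists y, y'; rewrite expn0 !expr1; split=> //.
    have -> : y - y' = y * ((d%:C * l) *: c) * y'.
      have -> : (d%:C * l) *: c = (1 - (s%:C * l) *: c) - (1 - l *: c).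
        rewrite opprB addrC addrA subrK -scalerBl -[X in X - _]mul1r -mulrBl.
        by rewrite -{1}(rmorph1 (real_complex R)) -rmorphB /s opprB addrC subrK.
      by rewrite mulrBr mulrBl hy.2 mul1r -mulrA hy'.1 mulr1.
    have : cnorm (y * ((d%:C * l) *: c) * y') <= B * d * (2 * B).
      apply: ler_cnM; last by apply: le_trans ny' _; rewrite ler_pM2l.
      by apply: ler_cnM => //; rewrite cnZ cabsM cabs_real l1 c1 !mulr1 gtr0_norm.
    move=> /le_trans; apply; nra.
  (* Replacing l by z l changes the sign of the 2^k-th power of [l *: c], so the induction
     hypothesis at l and at z l provides the two inverses to be averaged. *)
  pose z : R[i] := (2 ^ k).-root (-1).
  have zk : z ^+ (2 ^ k) = -1 by rewrite rootCK// expn_gt0.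
  have z1 : cabs z = 1.
    apply/eqP; rewrite -(@pexpr_eq1 _ _ (2 ^ k)) ?expn_gt0 ?cabs_ge0//.
    by rewrite -cabsX zk cabsN cabs1.
  have [Y1 [Y1' [a1 a2 a3]]] := IH l l1.
  have [] := IH (z * l); first by rewrite cabsM z1 l1 mulr1.
  move=> Y2 [Y2' [b1 b2 b3]].
  exists (2^-1%:C *: (Y1 + Y2)), (2^-1%:C *: (Y1' + Y2')).
  rewrite !expnSr !exprM !expr2; split.
  - apply: inverse_of_sqr => //; move: b1.
    by rewrite -scalerA exprZn zk scaleN1r opprK.
  - apply: inverse_of_sqr => //; move: b2.
    by rewrite (mulrCA _ z l) -(scalerA z) exprZn zk scaleN1r opprK.
  rewrite -scalerBr cn_realZ opprD addrACA ger0_norm ?invr_ge0//.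
  have := ler_cnD a3 b3; lra.
(* At l = 1 the power s^(2^N) is small, so Y' is near 1, and hence so is Y; but [c ^+ (2 ^ N)] still
   has norm 1. *)
have [N HN] := expr_small s0 (ltac:(lra) : 0 < 16^-1 :> R).
have [Y [Y' [h1 h2 h3]]] := P N 1 (@cabs1 R).
move: h1 h2; rewrite mulr1 scale1r exprZn -rmorphXn /=.
have sN : s ^+ (2 ^ N) < 16^-1 by apply: HN; rewrite ltnW// ltn_expl.
have cN : cnorm (c ^+ (2 ^ N)) = 1 by rewrite cn_sa_exp2// c1 expr1n.
set x := c ^+ (2 ^ N) in cN *; set e := s ^+ (2 ^ N) in sN * => h1 h2.
have e0 : 0 <= e by rewrite exprn_ge0; case/andP: s0.
have E' : Y' - 1 = (e%:C *: x) * Y'.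
  by rewrite -[in LHS]h2.1 mulrBl mul1r opprB addrC subrK.
have n1 : cnorm (Y' - 1) <= e * cnorm Y'.
  rewrite E'; apply: le_trans (ler_cnormM _ _) _.
  by rewrite cn_realZ cN mulr1 ger0_norm.
have n2 : cnorm Y' <= cnorm (Y' - 1) + 1.
  by rewrite -{1}(subrK 1 Y'); apply: ler_cnD; rewrite ?cn1.
have n3 : cnorm (Y - 1) <= 4^-1.
  have := cn_dist h3 n1; have := cn_ge0 Y'; nra.
have EY : Y - 1 = x * Y by rewrite -[in LHS]h1.1 mulrBl mul1r opprB addrC subrK.
have E : x = (Y - 1) - x * (Y - 1) by rewrite mulrBr mulr1 -EY opprB addrC subrK.
have : cnorm x <= 4^-1 + 1 * 4^-1.
  by rewrite {1}E; apply: ler_cnB => //; apply: ler_cnM; rewrite // cN.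
rewrite cN; lra.
Qed.

Lemma sa_spec_norm c : sa c -> exists t, `|t| = cnorm c /\ spec c t%:C.
Proof.
move=> h; have [c0|c0] := eqVneq c 0.
  exists 0; rewrite normr0 c0 cn0; split=> // -[y []].
  by rewrite rmorph0 scale0r subr0 mul0r => /eqP; rewrite eq_sym oner_eq0.
have n0 : 0 < cnorm c by rewrite cn_gt0.
set n := cnorm c in n0 *.
have nC : n%:C != 0 :> R[i] by rewrite (inj_eq (@complexI R) n 0) gt_eqF.
pose d := (n^-1)%:C *: c.
have sd : sa d by rewrite /sa /d star_realZ h.
have d1 : cnorm d = 1 by rewrite cn_realZ ger0_norm ?invr_ge0 ?ltW// mulVf ?gt_eqF.
have cd : c = n%:C *: d.
  by rewrite /d scalerA -rmorphM /= divff ?gt_eqF// scale1r.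
apply: contrapT => H; apply: (sa_unit_spec sd d1); split.
  have i1 : invertible (c - n%:C%:A).
    by apply: contrapT => hn; apply: H; exists n; split; [rewrite gtr0_norm// | exact: hn].
  rewrite -opprB; apply: invertibleN.
  have -> : d - 1 = (n%:C)^-1 *: (c - n%:C%:A).
    by rewrite {1}cd -scalerBr scalerA mulVf// scale1r.
  by apply: invertibleZ; rewrite ?invr_eq0.
have i1 : invertible (c - (- n)%:C%:A).
  by apply: contrapT => hn; apply: H; exists (- n); split; [rewrite normrN gtr0_norm// | exact: hn].
have -> : 1 + d = (n%:C)^-1 *: (c - (- n)%:C%:A).
  by rewrite {1}cd rmorphN scaleNr opprK -scalerDr scalerA mulVf// scale1r addrC.
by apply: invertibleZ; rewrite ?invr_eq0.
Qed.
End SelfAdjoint.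
(** * Polynomial calculus and positivity *)

Section PolyCalculus.
Context {R : realType}.
Local Open Scope complex_scope.
Context {A : cstarAlgType R}.
Implicit Types (x y z : A) (a b l : R[i]) (r s t : R).

Lemma horner_alg_comm x (p q : {poly R[i]}) :
  horner_alg x p * horner_alg x q = horner_alg x q * horner_alg x p.
Proof. by rewrite -!rmorphM mulrC. Qed.

Lemma horner_algXsubC x l : horner_alg x ('X - l%:P) = x - l%:A.
Proof. by rewrite rmorphB /= horner_algX horner_algC. Qed.

Lemma spec_horner_alg x l (p : {poly R[i]}) : spec x l -> spec (horner_alg x p) p.[l].
Proof.
move=> sp; rewrite /spec /=; apply: contra_not sp.
have /factor_theorem[q eq] : root (p - p.[l]%:P) l by rewrite rootE !hornerE subrr.
have -> : horner_alg x p - p.[l]%:A = (x - l%:A) * horner_alg x q.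
  by rewrite -horner_algXsubC horner_alg_comm -rmorphM -eq rmorphB /= horner_algC.
by apply: invertible_mull; rewrite -horner_algXsubC horner_alg_comm.
Qed.

(** Split p - m into linear factors over the complex numbers: if no root lies in the spectrum, every
    factor is invertible. A point of the spectrum is assumed for the case where p is the constant
    m. *)
Lemma horner_alg_spec x m (p : {poly R[i]}) : (exists l, spec x l) ->
  spec (horner_alg x p) m -> exists l, spec x l /\ m = p.[l].
Proof.
move=> [l0 hl0] sp.
have [e|q0] := eqVneq (p - m%:P) 0.
  exists l0; split=> //; have -> : p = m%:P by apply/eqP; rewrite -subr_eq0 e.
  by rewrite hornerC.
apply: contrapT => H; apply: sp.
rewrite -(horner_algC x) -rmorphB.
have rt w : root (p - m%:P) w -> invertible (x - w%:A).
  move=> rz; apply: contrapT => hz; apply: H; exists w; split=> //.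
  by move: rz; rewrite rootE !hornerE subr_eq0 => /eqP.
move: q0 rt; set q := p - _ => q0.
have [s ->] := closed_field_poly_normal q.
rewrite -mul_polyC rmorphM /= horner_algC mulr_algl => rt.
have c0 : lead_coef q != 0 by rewrite lead_coef_eq0.
apply: invertibleZ => //.
have {}rt w : w \in s -> invertible (x - w%:A).
  by move=> zs; apply: rt; rewrite rootE hornerM hornerC horner_prod mulf_eq0 (negPf c0)
    prodf_seq_eq0; apply/hasP; exists w; rewrite // !hornerE subrr.
elim: s rt => [|u s IH] rt.
  by rewrite big_nil rmorph1; exists 1; split; rewrite mulr1.
rewrite big_cons rmorphM /=; apply: invertibleM.
  by rewrite horner_algXsubC; apply: rt; rewrite inE eqxx.
by apply: IH => w ws; apply: rt; rewrite inE ws orbT.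
Qed.

(** Real coefficients keep self-adjoint elements self-adjoint, so that norms of values are suprema
    over the real spectrum. *)
Definition rhorner x (p : {poly R}) : A := horner_alg x (map_poly (real_complex R) p).

Lemma rhornerD x p q : rhorner x (p + q) = rhorner x p + rhorner x q.
Proof. by rewrite /rhorner !rmorphD. Qed.

Lemma rhornerB x p q : rhorner x (p - q) = rhorner x p - rhorner x q.
Proof. by rewrite /rhorner !rmorphB. Qed.

Lemma rhornerM x p q : rhorner x (p * q) = rhorner x p * rhorner x q.
Proof. by rewrite /rhorner !rmorphM. Qed.

Lemma rhornerC x r : rhorner x r%:P = r%:C%:A.
Proof. by rewrite /rhorner map_polyC /= horner_algC. Qed.

Lemma rhornerX x : rhorner x 'X = x.
Proof. by rewrite /rhorner map_polyX horner_algX. Qed.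

Lemma rhorner_sa x p : sa x -> sa (rhorner x p).
Proof.
move=> sx; elim/poly_ind: p => [|p c IH].
  by rewrite /sa /rhorner !rmorph0 star0.
rewrite /sa rhornerD rhornerM rhornerC rhornerX starD starM sx IH star_realZ star1.
by rewrite /rhorner -{1}(horner_algX x) horner_alg_comm horner_algX.
Qed.

Definition rspec x : set R := [set t | spec x t%:C].

Lemma sa_specE x a : sa x -> spec x a -> a = (complex.Re a)%:C /\ rspec x (complex.Re a).
Proof.
move=> sx sp; have h := sa_spec_real sx sp.
suff e : a = (complex.Re a)%:C by split=> //; rewrite /rspec /= -e.
by apply/eqP; rewrite eq_complex /= h !eqxx.
Qed.

Lemma rspec_le x t : rspec x t -> `|t| <= cnorm x.
Proof. by move=> /spec_le; rewrite cabs_real. Qed.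

Lemma rspec_norm x : sa x -> exists t, rspec x t /\ cnorm x = `|t|.
Proof. by move=> /sa_spec_norm[t [ht st]]; exists t. Qed.

Lemma rspec_rhorner x p t : rspec x t -> rspec (rhorner x p) p.[t].
Proof.
move=> sp; have := @spec_horner_alg _ _ (map_poly (real_complex R) p) sp.
by rewrite horner_map.
Qed.

Lemma rhorner_rspec x p t : sa x -> rspec (rhorner x p) t ->
  exists s, rspec x s /\ t = p.[s].
Proof.
move=> sx /horner_alg_spec[].
  by have [s [hs _]] := rspec_norm sx; exists s%:C.
move=> l [/(sa_specE sx)[e hl]].
rewrite e horner_map /= => /complexI ->.
by exists (complex.Re l).
Qed.

Lemma cn_rhorner x p : sa x -> exists t, rspec x t /\ cnorm (rhorner x p) = `|p.[t]|.
Proof.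
move=> sx; have [t [/(rhorner_rspec sx)[s [hs ->]] ->]] := rspec_norm (rhorner_sa p sx).
by exists s.
Qed.

Lemma rhorner_le_cn x p t : rspec x t -> `|p.[t]| <= cnorm (rhorner x p).
Proof. by move=> h; apply: rspec_le; apply: rspec_rhorner. Qed.

Lemma cn_rhorner_le x p r : sa x -> (forall t, rspec x t -> `|p.[t]| <= r) ->
  cnorm (rhorner x p) <= r.
Proof. by move=> sx H; have [t [ht ->]] := cn_rhorner p sx; apply: H. Qed.

Definition cpos x := sa x /\ forall t, rspec x t -> 0 <= t.

(** Both sides say |r - t| <= r on the spectrum. The norm form is what adds up, the spectrum of a
    sum not being controlled by those of its terms. *)
Lemma cposP x r : sa x -> cnorm x <= r -> cpos x <-> cnorm (r%:C%:A - x) <= r.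
Proof.
move=> sx xr; have e : r%:C%:A - x = rhorner x (r%:P - 'X).
  by rewrite rhornerB rhornerC rhornerX.
rewrite e; split=> [[_ h]|h].
  apply: cn_rhorner_le => // t ht; rewrite !hornerE.
  have := h _ ht; have := rspec_le ht; rewrite !ler_norml; lra.
split=> // t ht; have := le_trans (rhorner_le_cn (r%:P - 'X) ht) h.
rewrite !hornerE ler_norml; lra.
Qed.

Lemma cposD x y : cpos x -> cpos y -> cpos (x + y).
Proof.
move=> px py; have sxy : sa (x + y) by rewrite /sa starD px.1 py.1.
apply/(@cposP _ (cnorm x + cnorm y)) => //; first exact: ler_cnormD.
rewrite rmorphD scalerDl opprD addrACA.
by apply: ler_cnD; apply/cposP => //; [apply: px.1 | apply: py.1].
Qed.

Lemma cpos_rhorner x p : sa x -> (forall t, rspec x t -> 0 <= p.[t]) -> cpos (rhorner x p).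
Proof.
move=> sx H; split; first exact: rhorner_sa.
by move=> t /(rhorner_rspec sx)[s [/H hs ->]].
Qed.

Lemma cpos_sqr x : sa x -> cpos (x * x).
Proof.
move=> sx; have -> : x * x = rhorner x ('X * 'X) by rewrite rhornerM rhornerX.
by apply: cpos_rhorner => // t _; rewrite !hornerE -expr2 sqr_ge0.
Qed.

Lemma cposZ r x : 0 <= r -> cpos x -> cpos (r%:C *: x).
Proof.
move=> r0 [sx px].
have -> : r%:C *: x = rhorner x (r%:P * 'X) by rewrite rhornerM rhornerC rhornerX mulr_algl.
by apply: cpos_rhorner => // t /px; rewrite !hornerE; apply: mulr_ge0.
Qed.

Lemma cpos_cn x : sa x -> cpos ((cnorm x)%:C%:A - x).
Proof.
move=> sx; have -> : (cnorm x)%:C%:A - x = rhorner x ((cnorm x)%:P - 'X).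
  by rewrite rhornerB rhornerC rhornerX.
apply: cpos_rhorner => // t /rspec_le; rewrite !hornerE subr_ge0.
by apply: le_trans; apply: ler_norm.
Qed.

(** With M the norm of x + y, M - x = (M - (x + y)) + y is positive, so the spectral value of x that
    equals its norm is at most M. *)
Lemma cn_le_cpos x y : cpos x -> cpos y -> cnorm x <= cnorm (x + y).
Proof.
move=> px py; have pxy := cposD px py.
have := cposD (cpos_cn pxy.1) py.
rewrite opprD addrA subrK.
have [t [ht ->]] := rspec_norm px.1; rewrite ger0_norm ?px.2//.
set M := cnorm _ => -[_ H].
have -> : t = M - (M - t) by rewrite opprB addrC subrK.
rewrite lerBlDr lerDl; apply: H.
have -> : M%:C%:A - x = rhorner x (M%:P - 'X) by rewrite rhornerB rhornerC rhornerX.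
have -> : M - t = (M%:P - 'X).[t] by rewrite !hornerE.
exact: rspec_rhorner.
Qed.

(** The inverse 1 + y z x is suggested by the geometric series: y (1 + x y + ...) x collects the
    later terms of the series for 1 - y x. *)
Lemma jacobson x y : invertible (1 - x * y) -> invertible (1 - y * x).
Proof.
move=> [z [h1 h2]]; exists (1 + y * z * x); split.
  rewrite mulrDr mulr1 mulrBl mul1r -addrA; apply/eqP; rewrite -subr_eq0 addrAC subrr add0r.
  have -> : y * x * (y * z * x) = y * (x * y * z) * x by rewrite !mulrA.
  rewrite -mulrBl -mulrBr; have -> : z - x * y * z = 1 by rewrite -h1 mulrBl mul1r.
  by rewrite mulr1 addNr.
rewrite mulrDl mul1r mulrBr mulr1 -addrA; apply/eqP; rewrite -subr_eq0 addrAC subrr add0r.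
have -> : y * z * x * (y * x) = y * (z * (x * y)) * x by rewrite !mulrA.
rewrite -mulrBl -mulrBr; have -> : z - z * (x * y) = 1 by rewrite -h2 mulrBr mulr1.
by rewrite mulr1 addNr.
Qed.

Lemma spec_mulC x y a : a != 0 -> spec (x * y) a -> spec (y * x) a.
Proof.
move=> a0; rewrite /spec /=; apply: contra_not.
have H u v : u * v - a%:A = (- a) *: (1 - (a^-1 *: u) * v).
  by rewrite scalerBr -scalerAl scalerA mulNr divff// !scaleNr scale1r opprK addrC.
move=> h; rewrite H; apply: invertibleZ; first by rewrite oppr_eq0.
rewrite -scalerAl scalerAr; apply: jacobson.
have -> : 1 - a^-1 *: y * x = (- a)^-1 *: (y * x - a%:A).
  by rewrite H scalerA mulVf ?scale1r// oppr_eq0.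
by apply: invertibleZ; rewrite // invr_eq0 oppr_eq0.
Qed.

(** Bernoulli gives 1 + t N <= (1 + t)^N, and (1 + t)^N (1 - t)^N <= 1. *)
Lemma bernoulli_bound t N : 0 <= t <= 1 -> t * (1 - t) ^+ N * N%:R <= 1.
Proof.
move=> /andP[t0 t1].
have B : 1 + t * N%:R <= (1 + t) ^+ N.
  elim: N => [|N IH]; first by rewrite mulr0 addr0 expr0.
  rewrite exprS; apply: le_trans (_ : (1 + t) * (1 + t * N%:R) <= _).
    have : 0 <= N%:R :> R by [].
    rewrite -natr1; move: (N%:R : R) => n n0.
    have : 0 <= t * t * n by rewrite !mulr_ge0.
    lra.
  by rewrite ler_wpM2l//; lra.
have : (1 - t) ^+ N * (1 + t) ^+ N <= 1.
  rewrite -exprMn exprn_ile1//; nra.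
have : 0 <= (1 - t) ^+ N by rewrite exprn_ge0//; lra.
set u := _ ^+ N; set v := _ ^+ N in B *; set n := N%:R in B *; nra.
Qed.

(** [y] and [z] are, up to sign, twice the real and imaginary parts of [x]. It follows that
    [star x * x] is bounded below by the negative of [x * star x]. *)
Lemma mul_star_add x : exists y z, [/\ sa y, sa z &
  star x * x + x * star x = 2^-1%:C *: (y * y + z * z)].
Proof.
exists (x + star x), ('i *: (x - star x)); split.
- by rewrite /sa starD starK addrC.
- rewrite /sa starZ starB starK -[x - star x]opprB scalerN -scaleNr.
  by congr (_ *: _); apply/eqP; rewrite eq_complex /= !oppr0 !eqxx.
have ii : 'i * 'i = -1 :> R[i] by rewrite -expr2 sqr_i.
rewrite -scalerAl -scalerAr scalerA ii scaleN1r.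
rewrite mulrBl !mulrBr mulrDl !mulrDr.
have -> : forall a b c d : A, (a + b + (c + d) - (a - b - (c - d))) = (c + b) *+ 2.
  move=> a b c d; rewrite !opprB (addrC (c - d)) addrACA (addrCA (a + b)) (addrC a) addrK.
  by rewrite (addrCA (c + d)) addrK addrC mulr2n addrACA.
rewrite -(scaler_nat 2 (_ : A)) scalerA -(rmorph_nat (real_complex R)).
by rewrite -rmorphM /= mulVf ?pnatr_eq0// scale1r.
Qed.

(* Kaplansky's argument, with the polynomial [(1 - t / r) ^ N] instead of the
   negative part of [c = star x * x]: if [t0 < 0] is in the spectrum of [c], then
   [b = x (1 - c / r) ^ N] has [star b * b <= e] with [e] small, hence
   [- e <= star b * b], although [t0 (1 - t0 / r) ^ 2N <= t0] is in its spectrum. *)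
Lemma cpos_star_mul x : cpos (star x * x).
Proof.
set c := star x * x; have sc : sa c by rewrite /sa /c starM starK.
split=> // t0 ht0; rewrite leNgt; apply/negP => t0n.
have r0 : 0 < cnorm c by have := rspec_le ht0; apply: lt_le_trans; rewrite normr_gt0 lt_eqF.
set r := cnorm c in r0 *.
(* This makes e = r / (2 N) smaller than - t0, which contradicts e + k >= 0 at t0, where k is at
   most t0. *)
have [N HN] : exists N : nat, r < - t0 * N%:R.
  exists (Num.bound (r / - t0)); rewrite mulrC -ltr_pdivrMr ?oppr_gt0//.
  by apply: le_lt_trans (archi_boundP _); rewrite ?ler_norm// divr_ge0 ?ltW ?oppr_gt0.
pose g : {poly R} := (1 - r^-1 *: 'X) ^+ N.
pose k : {poly R} := g * 'X * g.
have kE t : k.[t] = t * (1 - r^-1 * t) ^+ (N + N).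
  by rewrite /k !hornerE exprD mulrA (mulrC t).
pose b := x * rhorner c g.
have bb : star b * b = rhorner c k.
  by rewrite /b starM (rhorner_sa g sc) /k !rhornerM rhornerX /c !mulrA.
have N0 : (0 < N)%N by case: N HN {g k kE b bb} => //; rewrite mulr0 ltNge ltW.
have n0 : 0 < N%:R :> R by rewrite ltr0n.
(* On positive spectral values, [bernoulli_bound] with exponent 2 N, rescaled by r, bounds k by e;
   elsewhere k <= 0. *)
pose e := r / (N + N)%:R.
have e0 : 0 <= e by rewrite divr_ge0 // ltW.
have ks t : rspec c t -> k.[t] <= e.
  move=> /rspec_le; rewrite -/r kE => tr.
  have [t1|t1] := lerP t 0.
    apply: le_trans e0; rewrite mulr_le0_ge0//.
    by rewrite addnn -mul2n exprM exprn_ge0// sqr_ge0.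
  have tr1 : r^-1 * t <= 1.
    by rewrite mulrC ler_pdivrMr// mul1r; apply: le_trans tr; apply: ler_norm.
  have tr0 : 0 <= r^-1 * t by rewrite mulr_ge0 ?invr_ge0 ?ltW.
  have := @bernoulli_bound (r^-1 * t) (N + N) (introT andP (conj tr0 tr1)).
  rewrite /e ler_pdivlMr ?ltr0n ?addn_gt0 ?N0// => h.
  rewrite [leLHS](_ : _ = r * (r^-1 * t * (1 - r^-1 * t) ^+ (N + N) * (N + N)%:R)).
    by apply: ler_piMr; rewrite // ltW.
  by rewrite !mulrA divff ?mul1r// gt_eqF.
(* The spectra of [star b * b] and [b * star b] agree away from 0, so the upper bound passes from
   the first to the second. *)
have pbs : cpos (e%:C%:A - b * star b).
  split; first by rewrite /sa starB star_alg conj_real starM starK.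
  move=> t ht.
  have h : spec (b * star b) ((e - t)%:C).
    move: ht; rewrite /rspec /spec /=; apply: contra_not => /invertibleN.
    by rewrite rmorphB scalerBl opprB addrAC.
  have [->|te] := eqVneq t e; first exact: e0.
  have : rspec (star b * b) (e - t).
    by apply: spec_mulC h; rewrite (inj_eq (@complexI R) _ 0) subr_eq0 eq_sym.
  rewrite bb => /(rhorner_rspec sc)[s [/ks hs E]].
  by move: hs; rewrite -E; lra.
have [y [z [sy sz E]]] := mul_star_add b.
have P : cpos (e%:C%:A + rhorner c k).
  have -> : e%:C%:A + rhorner c k = (e%:C%:A - b * star b) + 2^-1%:C *: (y * y + z * z).
    by rewrite -E addrA addrAC subrK -bb addrC.
  by apply: cposD pbs _; apply: cposZ; rewrite ?invr_ge0//; apply: cposD; apply: cpos_sqr.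
move: P; rewrite -(rhornerC c) -rhornerD => -[_ /(_ (e%:P + k).[t0])].
have sp0 : rspec (rhorner c (e%:P + k)) (e%:P + k).[t0] by apply: rspec_rhorner.
move=> /(_ sp0); rewrite hornerD hornerC kE.
have : 1 <= (1 - r^-1 * t0) ^+ (N + N).
  rewrite exprn_ege1// lerDl oppr_ge0 mulr_ge0_le0 ?invr_ge0 ?ltW//.
have : e * N%:R * 2 = r.
  by rewrite -mulrA mulr_natr mulr2n -natrD /e divfK// gt_eqF// ltr0n addn_gt0 N0.
move=> h1 h2 h3.
have h4 : t0 * (1 - r^-1 * t0) ^+ (N + N) <= t0 by rewrite ger_nMr.
have h5 : - t0 * N%:R <= e * N%:R by rewrite ler_pM2r//; lra.
lra.
Qed.

Lemma cpos0 : cpos (0 : A).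
Proof. by have := cpos_star_mul (0 : A); rewrite mulr0. Qed.

Lemma cpos_sum_star I (s : seq I) (F : I -> A) : cpos (\sum_(i <- s) star (F i) * F i).
Proof.
elim: s => [|i s IH]; first by rewrite big_nil; apply: cpos0.
by rewrite big_cons; apply: cposD => //; apply: cpos_star_mul.
Qed.

End PolyCalculus.
(** * Unital star-homomorphisms *)

Section SqrtPoly.
Context {R : realType}.
Implicit Types (s t e : R).

(* Newton-type iteration converging to [sqrt v], uniformly for [v] in [0, 1]. *)
Fixpoint sqrt_poly (n : nat) : {poly R} :=
  if n is n'.+1 then sqrt_poly n' + 2^-1 *: ('X - sqrt_poly n' * sqrt_poly n')
  else 1.

(** The argument is written s^2 so that the limit is s. The error d becomes at most d (1 - d / 2) at
    each step, and this recursion preserves the bound 2 / (n + 2). *)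
Lemma sqrt_poly_bound n s : 0 <= s <= 1 ->
  [/\ s <= (sqrt_poly n).[s ^+ 2], (sqrt_poly n).[s ^+ 2] <= 1
    & (sqrt_poly n).[s ^+ 2] - s <= 2 / n.+2%:R].
Proof.
move=> /andP[s0 s1]; elim: n => [|n [IH1 IH2 IH3]] /=.
  by rewrite hornerC divff ?pnatr_eq0//; split; lra.
rewrite hornerD hornerZ hornerD hornerN hornerM hornerX.
set y := _.[_] in IH1 IH2 IH3 *; split; [nra|nra|].
have n0 : 0 < n.+2%:R :> R by [].
have -> : n.+3%:R = n.+2%:R + 1 :> R by rewrite -natr1.
move: IH3; rewrite !ler_pdivlMr; [|lra|lra].
move: (n.+2%:R : R) n0 => m m0 IH3.
have -> : y + 2^-1 * (s ^+ 2 - y * y) - s = (y - s) * (1 - (y + s) / 2) by field.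
set d := y - s in IH3 *.
have d0 : 0 <= d by rewrite subr_ge0.
have h1 : (1 - (y + s) / 2) <= 1 - d / 2 by rewrite /d; lra.
have h2 : d * (1 - (y + s) / 2) * (m + 1) <= d * (1 - d / 2) * (m + 1).
  by rewrite ler_pM2r ?ler_wpM2l//; lra.
apply: le_trans h2 _.
have d1 : d <= 1 by rewrite /d; lra.
have [dm|dm] := lerP (d * (m + 1)) 2.
  have : 0 <= d * d * (m + 1) by rewrite !mulr_ge0//; lra.
  lra.
nra.
Qed.

Lemma natr_inv_small e : 0 < e -> exists N, forall n, (N <= n)%N -> 2 / n.+2%:R <= e.
Proof.
move=> e0; exists (Num.bound (2 / e)) => n Nn.
rewrite ler_pdivrMr// mulrC -ler_pdivrMr//.
apply: le_trans (ltW (archi_boundP _)) _; first by rewrite divr_ge0// ltW.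
by rewrite ler_nat; apply: leq_trans Nn _; rewrite -addn2 leq_addr.
Qed.
End SqrtPoly.

Section Hom.
Context {R : realType}.
Local Open Scope complex_scope.

(** Unbundled, because conjugations and homomorphisms obtained by choice arise as plain
    functions. *)
Record star_morph (A B : cstarAlgType R) (h : A -> B) : Prop := {
  star_morph1 : h 1 = 1 ;
  star_morph_lin : forall (a : R[i]) x y, h (a *: x + y) = a *: h x + h y ;
  star_morphM : forall x y, h (x * y) = h x * h y ;
  star_morph_star : forall x, h (star x) = star (h x)
}.

Lemma star_hom_morph (A B : cstarAlgType R) (f : {lrmorphism A -> B}) :
  star_hom f -> star_morph f.
Proof.
move=> hf; split=> // [|a x y|x y]; first exact: rmorph1.
  exact: linearP.
exact: rmorphM.
Qed.

Context {A B : cstarAlgType R} (h : A -> B) (hm : star_morph h).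
Implicit Types (x y : A).

Lemma smorphD x y : h (x + y) = h x + h y.
Proof. by have := star_morph_lin hm 1 x y; rewrite !scale1r. Qed.

Lemma smorph0 : h 0 = 0.
Proof. by apply: (addrI (h 0)); rewrite -smorphD !addr0. Qed.

Lemma smorphZ a x : h (a *: x) = a *: h x.
Proof. by have := star_morph_lin hm a x 0; rewrite smorph0 !addr0. Qed.

Lemma smorphN x : h (- x) = - h x.
Proof. by rewrite -scaleN1r smorphZ scaleN1r. Qed.

Lemma smorphB x y : h (x - y) = h x - h y.
Proof. by rewrite smorphD smorphN. Qed.

Lemma smorph_sum I (s : seq I) (F : I -> A) :
  h (\sum_(i <- s) F i) = \sum_(i <- s) h (F i).
Proof. by elim: s => [|i s IH]; rewrite ?big_nil ?smorph0// !big_cons smorphD IH. Qed.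

Lemma smorph_alg a : h a%:A = a%:A.
Proof. by rewrite smorphZ (star_morph1 hm). Qed.

Lemma smorph_spec x : spec (h x) `<=` spec x.
Proof.
move=> a; apply: contra_not => -[y [h1 h2]]; exists (h y).
by split; rewrite -smorph_alg -smorphB -(star_morphM hm) ?h1 ?h2 (star_morph1 hm).
Qed.

Lemma smorph_sa x : sa x -> sa (h x).
Proof. by move=> sx; rewrite /sa -(star_morph_star hm) sx. Qed.

(** Homomorphisms shrink spectra, and the norm of the self-adjoint [star x * x] is read off its
    spectrum. *)
Lemma smorph_cn x : cnorm (h x) <= cnorm x.
Proof.
rewrite -ler_sqr ?nnegrE ?cn_ge0// -!cnorm_starM -(star_morph_star hm) -(star_morphM hm).
have [|t [ht ->]] := @rspec_norm _ _ (h (star x * x)).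
  by apply: smorph_sa; rewrite /sa starM starK.
by apply: rspec_le; apply: smorph_spec.
Qed.

Lemma smorph_rhorner x (p : {poly R}) : h (rhorner x p) = rhorner (h x) p.
Proof.
elim/poly_ind: p => [|p c IH]; first by rewrite /rhorner !rmorph0 smorph0.
by rewrite !rhornerD !rhornerM !rhornerX !rhornerC smorphD (star_morphM hm) IH smorph_alg.
Qed.

(* If [h] decreased the norm of a positive [a], then [h] would kill the limit of
   [q n] at [a], where [q n] converges to twice the positive part of
   [(t - cnorm (h a)) / cnorm a]. *)
Lemma smorph_isometry : injective h -> forall x, cnorm (h x) = cnorm x.
Proof.
move=> ih x; apply/eqP; rewrite eq_le smorph_cn/=.
rewrite -ler_sqr ?nnegrE ?cn_ge0// -!cnorm_starM -(star_morph_star hm) -(star_morphM hm).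
set a := star x * x; have [sa_ pa] : cpos a := cpos_star_mul x.
set rho := cnorm (h a); set r := cnorm a.
rewrite leNgt; apply/negP => rr.
have rho0 : 0 <= rho by apply: cn_ge0.
have r0 : 0 < r by apply: le_lt_trans rr.
pose sg : {poly R} := r^-1 *: ('X - rho%:P).
pose q n : {poly R} := (sqrt_poly n \Po (sg ^+ 2)) + sg.
have sgE t : sg.[t] = (t - rho) / r by rewrite /sg hornerZ !hornerE mulrC.
have qE n t : (q n).[t] = (sqrt_poly n).[ `|sg.[t]| ^+ 2] + sg.[t].
  by rewrite /q hornerD horner_comp horner_exp real_normK ?num_real.
have bd t : rspec a t -> 0 <= `|sg.[t]| <= 1.
  move=> ht; rewrite normr_ge0/= sgE normrM normfV (gtr0_norm r0) ler_pdivrMr// mul1r.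
  by have := rspec_le ht; have := pa t ht; rewrite -/r !ler_norml; lra.
have dq N m n : (N <= m)%N -> (N <= n)%N -> cnorm (rhorner a (q m) - rhorner a (q n)) <= 2 / N.+2%:R.
  move=> Nm Nn; rewrite -rhornerB; apply: cn_rhorner_le => // t ht.
  rewrite hornerD hornerN !qE opprD addrACA subrr addr0.
  have [h1 h2 h3] := sqrt_poly_bound m (bd t ht).
  have [h4 h5 h6] := sqrt_poly_bound n (bd t ht).
  have h7 : 2 / m.+2%:R <= 2 / N.+2%:R :> R.
    by rewrite ler_pM2l// lef_pV2 ?posrE// ler_nat.
  have h8 : 2 / n.+2%:R <= 2 / N.+2%:R :> R.
    by rewrite ler_pM2l// lef_pV2 ?posrE// ler_nat.
  move: (2 / m.+2%:R) (2 / n.+2%:R) (2 / N.+2%:R) h3 h6 h7 h8 => um un uN h3 h6 h7 h8.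
  rewrite ler_norml; lra.
have [l Hl] : exists l : A, forall eps : R, 0 < eps -> exists N, forall n,
       (N <= n)%N -> cnorm (rhorner a (q n) - l) < eps.
  apply: cnorm_complete => e e0.
  have [N HN] := natr_inv_small (ltac:(lra) : 0 < e / 2).
  exists N => m n Nm Nn; apply: le_lt_trans (dq _ _ _ Nm Nn) _.
  by apply: le_lt_trans (HN _ (leqnn N)) _; lra.
(* The spectrum of [h a] lies below rho, where |sg| + sg vanishes and only the error of [sqrt_poly]
   remains. *)
have hq n : cnorm (h (rhorner a (q n))) <= 2 / n.+2%:R.
  rewrite smorph_rhorner; apply: cn_rhorner_le; first exact: smorph_sa.
  move=> t ht; have h0 := bd t (smorph_spec ht).
  have := rspec_le ht; rewrite -/rho qE ler_norml => /andP[_ tr].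
  have [h1 h2 h3] := sqrt_poly_bound n h0.
  have e : `|sg.[t]| = - sg.[t].
    by rewrite ler0_norm// sgE mulr_le0_ge0 ?invr_ge0 ?(ltW r0)// subr_le0.
  have n0 : 0 <= 2 / n.+2%:R :> R by rewrite divr_ge0.
  move: (2 / n.+2%:R) n0 h3 => u n0 h3; rewrite ler_norml; lra.
have l0 : l = 0.
  apply: ih; rewrite smorph0; apply: cn_sub_eq0 => e e0; rewrite subr0.
  have e2 : 0 < e / 2 by lra.
  have [N HN] := natr_inv_small e2; have [M HM] := Hl _ e2.
  have hN := HN _ (leq_maxl N M); have hM := HM _ (leq_maxr N M).
  have := hq (maxn N M) => hn.
  have : cnorm (h l) <= cnorm (rhorner a (q (maxn N M)) - l) + cnorm (h (rhorner a (q (maxn N M)))).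
    rewrite cnB -{1}(subrK (rhorner a (q (maxn N M))) l) smorphD.
    by apply: ler_cnD => //; apply: smorph_cn.
  move: (2 / _) hN hn => u hN hn; lra.
(* At the spectral value r of [a], [q n] stays above sg(r) > 0, so its limit cannot be 0. *)
have [t [ht et]] := rspec_norm sa_.
have tE : t = r by rewrite /r et ger0_norm ?pa.
have s0 : 0 < sg.[r] by rewrite sgE divr_gt0// subr_gt0.
have [N HN] := Hl _ s0.
have := HN N (leqnn N); rewrite l0 subr0 ltNge => /negP; apply.
rewrite tE in ht.
apply: le_trans (rhorner_le_cn (q N) ht); rewrite qE.
have [h1 _ _] := sqrt_poly_bound N (bd _ ht).
apply: le_trans (ler_norm _); rewrite lerDr.
by apply: le_trans h1.
Qed.
End Hom.

(** [s] is a polynomial in [star z * z] approximating the square root of its complement. The root is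
    within e / 2 and both numbers are at most 1, so the squares differ by at most e. *)
Lemma approx_sqrt_compl {R : realType} (A : cstarAlgType R) (z : A) (e : R) :
  cnorm z <= 1 -> 0 < e ->
  exists s, cnorm (1 - star z * z - star s * s) <= e.
Proof.
move=> z1 e0; set c := star z * z; have [sc pc] : cpos c := cpos_star_mul z.
have [N HN] := natr_inv_small (ltac:(lra) : 0 < e / 2).
pose p : {poly R} := sqrt_poly N \Po (1 - 'X).
exists (rhorner c p); rewrite (rhorner_sa p sc).
have -> : 1 - c - rhorner c p * rhorner c p = rhorner c (1 - 'X - p * p).
  by rewrite 2!rhornerB rhornerM rhornerX rhornerC rmorph1 scale1r.
apply: cn_rhorner_le => // t ht.
have t0 := pc t ht; have t1 : t <= 1.
  have := rspec_le ht; rewrite ger0_norm// /c cnorm_starM => /le_trans; apply.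
  by rewrite expr_le1 ?cn_ge0.
have v0 : 0 <= 1 - t by lra.
rewrite hornerD hornerN hornerM /p horner_comp !hornerE -(sqr_sqrtr v0).
have hb : 0 <= Num.sqrt (1 - t) <= 1.
  rewrite sqrtr_ge0 -ler_sqr ?nnegrE ?sqrtr_ge0// sqr_sqrtr//; lra.
have [h1 h2 h3] := sqrt_poly_bound N hb.
have := le_trans h3 (HN N (leqnn N)).
move: (Num.sqrt _) hb h1 h2 {h3} => s /andP[s0 s1]; move: (_.[_]) => y h1 h2 h3.
have h4 : 0 <= (y - s) * (2 - y - s) by rewrite mulr_ge0; lra.
rewrite ler_norml; apply/andP; split; nra.
Qed.
(** * Hilbert spaces and the spatial tensor product *)

Section Hilbert.
Context {R : realType}.
Local Open Scope complex_scope.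
Context {H : hilbertType R}.
Implicit Types (u v w : H) (a b : R[i]).

Lemma innerDl u v w : inner (u + v) w = inner u w + inner v w.
Proof. exact: linearDl. Qed.

Lemma innerZl a u v : inner (a *: u) v = a * inner u v.
Proof. exact: linearZl_LR. Qed.

Lemma innerC u v : inner u v = Num.conj (inner v u).
Proof. by rewrite hermC expr0 mul1r. Qed.

Lemma innerDr u v w : inner u (v + w) = inner u v + inner u w.
Proof. exact: linearDr. Qed.

Lemma innerZr a u v : inner u (a *: v) = Num.conj a * inner u v.
Proof. by rewrite innerC innerZl rmorphM /= -innerC. Qed.

Lemma inner0l u : inner 0 u = 0.
Proof. exact: linear0l. Qed.

Lemma inner0r u : inner u 0 = 0.
Proof. exact: linear0r. Qed.

Lemma inner_suml I (s : seq I) (F : I -> H) v :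
  inner (\sum_(i <- s) F i) v = \sum_(i <- s) inner (F i) v.
Proof. by elim: s => [|i s IH]; rewrite ?big_nil ?inner0l// !big_cons innerDl IH. Qed.

Lemma inner_sumr I (s : seq I) (F : I -> H) v :
  inner v (\sum_(i <- s) F i) = \sum_(i <- s) inner v (F i).
Proof. by elim: s => [|i s IH]; rewrite ?big_nil ?inner0r// !big_cons innerDr IH. Qed.

(** The squared norm as an element of [R]: the norm of [H] itself takes values in [R[i]]. *)
Definition hsq u : R := complex.Re (inner u u).

Lemma inner_hsq u : inner u u = (hsq u)%:C.
Proof. by rewrite /hsq RRe_real// -norm_inner ger0_real// exprn_ge0. Qed.

Lemma hsq_ge0 u : 0 <= hsq u.
Proof.
have : 0 <= inner u u by rewrite -norm_inner exprn_ge0.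
by rewrite inner_hsq lecR. Qed.

Lemma hsq_eq0 u : (hsq u == 0) = (u == 0).
Proof.
by rewrite -(inj_eq (@complexI R)) -inner_hsq -norm_inner expf_eq0/= normr_eq0.
Qed.

Lemma hsqZ a u : hsq (a *: u) = cabs a ^+ 2 * hsq u.
Proof.
apply: complexI; rewrite -inner_hsq innerZl innerZr mulrA mulr_conj inner_hsq.
by rewrite -rmorphM.
Qed.

(* Subtract the projections to the first vector, and recurse. *)
Lemma gram_decomposition (s : seq H) :
  exists J : seq (H -> R[i]), forall u v, u \in s -> v \in s ->
    inner u v = \sum_(c <- J) c u * Num.conj (c v).
Proof.
(* Adjoining 0 absorbs the projection of the vector [w] being eliminated, so that the list gets
   shorter. *)
suff [J HJ] : exists J : seq (H -> R[i]), forall u v, u \in 0 :: s -> v \in 0 :: s ->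
    inner u v = \sum_(c <- J) c u * Num.conj (c v).
  by exists J => u v us vs; apply: HJ; rewrite inE ?us ?vs orbT.
move e : (size s) => n; elim: n s e => [|n IH] [|w s]// => [_|[e]].
  by exists [::] => u v; rewrite !inE => /eqP-> /eqP->; rewrite inner0l big_nil.
pose pr u := u + (- (inner u w / inner w w)) *: w.
have [|J HJ] := IH (map pr s); first by rewrite size_map.
pose c0 u := inner u w / (Num.sqrt (hsq w))%:C.
exists (c0 :: [seq c \o pr | c <- J]) => u v us vs.
rewrite big_cons big_map.
have pr0 x : x \in 0 :: w :: s -> pr x \in 0 :: map pr s.
  rewrite !inE => /or3P[/eqP->|/eqP->|xs].
  - by rewrite /pr inner0l mul0r oppr0 scale0r addr0 eqxx.
  - rewrite /pr; have [->|w0] := eqVneq w 0; first by rewrite scaler0 addr0 eqxx.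
    by rewrite divff ?scaleN1r ?subrr ?eqxx// -norm_inner expf_neq0// normr_eq0.
  - by rewrite map_f// orbT.
rewrite -(HJ _ _ (pr0 _ us) (pr0 _ vs)).
have -> : c0 u * Num.conj (c0 v) = inner u w * Num.conj (inner v w) / inner w w.
  rewrite /c0 rmorphM /= fmorphV /= conj_real mulrACA -invfM -rmorphM /= -expr2.
  by rewrite sqr_sqrtr ?hsq_ge0// -inner_hsq.
rewrite /pr innerDl !innerDr !innerZl !innerZr.
rewrite rmorphN rmorphM /= fmorphV /= -(innerC w v) -innerC.
have [->|w0] := eqVneq w 0; first by rewrite !(inner0l, inner0r, mul0r, mulr0, oppr0, addr0, add0r).
have W : inner w w != 0 by rewrite -norm_inner expf_neq0// normr_eq0.
by move: (inner u v) (inner u w) (inner w v) (inner w w) W => p q r k k0; field.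
Qed.

End Hilbert.

(** * The inner product on the algebraic tensor product of Hilbert spaces *)

Section TensorInner.
Context {R : realType}.
Local Open Scope complex_scope.
Context {H K : hilbertType R}.
Implicit Types (z w : seq (H * K)) (a b : R[i]).

Lemma tinner_cat z w z' : tinner (z ++ w) z' = tinner z z' + tinner w z'.
Proof. by rewrite /tinner big_cat. Qed.

Lemma tinnerC z w : tinner z w = Num.conj (tinner w z).
Proof.
rewrite /tinner rmorph_sum /= exchange_big /=; apply: eq_bigr => p _.
rewrite rmorph_sum /=; apply: eq_bigr => q _.
by rewrite rmorphM /= -!innerC.
Qed.

Definition tscale a z : seq (H * K) := [seq (a *: p.1, p.2) | p <- z].

Lemma tinner_scale a z w : tinner (tscale a z) w = a * tinner z w.
Proof.
rewrite /tinner big_map mulr_sumr; apply: eq_bigr => p _.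
by rewrite mulr_sumr; apply: eq_bigr => q _; rewrite innerZl mulrA.
Qed.

Lemma tinner_catr z w z' : tinner z' (z ++ w) = tinner z' z + tinner z' w.
Proof. by rewrite tinnerC tinner_cat rmorphD /= -!tinnerC. Qed.

Lemma tinner_scaler a z w : tinner w (tscale a z) = Num.conj a * tinner w z.
Proof. by rewrite tinnerC tinner_scale rmorphM /= -tinnerC. Qed.

(** Coordinates for the second legs turn z into a finite family of vectors of H, and the tensor form
    into a sum of their squared norms; hence it is real and nonnegative. *)
Lemma tinner_gram z (J : seq (K -> R[i])) :
  (forall u v, u \in map snd z -> v \in map snd z ->
    inner u v = \sum_(c <- J) c u * Num.conj (c v)) ->
  tinner z z = (\sum_(c <- J) hsq (\sum_(p <- z) c p.2 *: p.1))%:C.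
Proof.
move=> HJ; rewrite rmorph_sum /=.
transitivity (\sum_(p <- z) \sum_(q <- z) \sum_(c <- J)
    inner (c p.2 *: p.1) (c q.2 *: q.1)).
  apply: eq_big_seq => p pz; apply: eq_big_seq => q qz.
  rewrite HJ ?map_f// mulr_sumr; apply: eq_bigr => c _.
  by rewrite innerZl innerZr; ring.
transitivity (\sum_(p <- z) \sum_(c <- J) \sum_(q <- z)
    inner (c p.2 *: p.1) (c q.2 *: q.1)).
  by apply: eq_bigr => p _; rewrite exchange_big.
rewrite exchange_big /=; apply: eq_bigr => c _.
rewrite -inner_hsq inner_suml; apply: eq_bigr => p _.
by rewrite inner_sumr.
Qed.

Definition tsq z : R := complex.Re (tinner z z).

Lemma tinner_tsq z : tinner z z = (tsq z)%:C.
Proof. by rewrite /tsq; have [J /tinner_gram->] := gram_decomposition (map snd z). Qed.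

Lemma tsq_ge0 z : 0 <= tsq z.
Proof.
rewrite /tsq; have [J /tinner_gram->] := gram_decomposition (map snd z).
by rewrite /= sumr_ge0// => c _; apply: hsq_ge0.
Qed.

Lemma tnormE z : tnorm z = Num.sqrt (tsq z).
Proof. by []. Qed.

Lemma tnorm_sqr z : tnorm z ^+ 2 = tsq z.
Proof. by rewrite tnormE sqr_sqrtr ?tsq_ge0. Qed.

Lemma tnorm_ge0 z : 0 <= tnorm z.
Proof. exact: sqrtr_ge0. Qed.

Lemma tsq_scale a z : tsq (tscale a z) = cabs a ^+ 2 * tsq z.
Proof.
apply: complexI; rewrite -tinner_tsq tinner_scale tinnerC tinner_scale.
by rewrite rmorphM /= -tinnerC mulrA mulr_conj tinner_tsq [RHS]rmorphM.
Qed.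

Lemma tnorm_scale a z : tnorm (tscale a z) = cabs a * tnorm z.
Proof.
by rewrite !tnormE tsq_scale sqrtrM ?sqr_ge0// sqrtr_sqr ger0_norm ?cabs_ge0.
Qed.

Lemma tsq1 (u : H) (v : K) : tsq [:: (u, v)] = hsq u * hsq v.
Proof.
by apply: complexI; rewrite -tinner_tsq /tinner !big_seq1 !inner_hsq rmorphM.
Qed.

Lemma tinner_cauchy z w : 0 < tsq w -> cabs (tinner z w) ^+ 2 <= tsq z * tsq w.
Proof.
set b := tinner z w; set W := tsq w => W0.
pose a := - b * (W^-1)%:C.
have := tsq_ge0 (z ++ tscale a w).
have -> : tsq (z ++ tscale a w) = tsq z - cabs b ^+ 2 / W.
  apply: complexI; rewrite -tinner_tsq tinner_cat tinner_scale !tinner_catr.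
  rewrite !tinner_scaler !tinner_tsq (tinnerC w z) -/W -/b.
  have -> : (tsq z - cabs b ^+ 2 / W)%:C = (tsq z)%:C - b * Num.conj b * (W%:C)^-1.
    by rewrite mulr_conj -fmorphV -rmorphM -rmorphB.
  have -> : Num.conj a = - Num.conj b * (W^-1)%:C.
    by rewrite /a rmorphM /= rmorphN conj_real.
  rewrite /a fmorphV.
  have W1 : W%:C != 0 :> R[i] by rewrite (inj_eq (@complexI R) W 0) gt_eqF.
  by field.
by rewrite subr_ge0 ler_pdivrMr.
Qed.

End TensorInner.

(** * The minimal norm: operator bounds, legs and slice maps *)

Section Tact.
Context {R : realType}.
Local Open Scope complex_scope.

Definition min_norm (D E T : cstarAlgType R) (H K : hilbertType R)
    (pi : D -> H -> H) (rho : E -> K -> K) (i1 : D -> T) (i2 : E -> T) :=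
  forall x : seq (D * E),
    supremums [set tnorm (tact pi rho x z) | z in [set z | tnorm z <= 1]]
      (cnorm (tsum i1 i2 x)).

Definition swap_pair (X Y : Type) (p : X * Y) := (p.2, p.1).

Lemma tinner_swap (H K : hilbertType R) (z w : seq (H * K)) :
  tinner (map (@swap_pair _ _) z) (map (@swap_pair _ _) w) = tinner z w.
Proof.
rewrite /tinner big_map; apply: eq_bigr => p _.
by rewrite big_map; apply: eq_bigr => q _; rewrite mulrC.
Qed.

Lemma tnorm_swap (H K : hilbertType R) (z : seq (H * K)) :
  tnorm (map (@swap_pair _ _) z) = tnorm z.
Proof. by rewrite /tnorm tinner_swap. Qed.

Lemma swap_pairK (X Y : Type) : cancel (@swap_pair X Y) (@swap_pair Y X).
Proof. by case. Qed.

Lemma map_swapK (X Y : Type) : cancel (map (@swap_pair X Y)) (map (@swap_pair Y X)).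
Proof. by move=> s; rewrite mapK//; apply: swap_pairK. Qed.

Lemma tact_swap (D E : cstarAlgType R) (H K : hilbertType R)
    (pi : D -> H -> H) (rho : E -> K -> K) x z :
  map (@swap_pair _ _) (tact pi rho x z) =
  tact rho pi (map (@swap_pair _ _) x) (map (@swap_pair _ _) z).
Proof.
rewrite /tact; elim: x => [|a x IH]//=.
by rewrite map_cat IH -!map_comp.
Qed.

Lemma tsum_swap (D E T : cstarAlgType R) (i1 : D -> T) (i2 : E -> T) x :
  (forall d e, i1 d * i2 e = i2 e * i1 d) ->
  tsum i2 i1 (map (@swap_pair _ _) x) = tsum i1 i2 x.
Proof. by move=> c; rewrite /tsum big_map; apply: eq_bigr => a _; rewrite c. Qed.

Lemma min_norm_swap (D E T : cstarAlgType R) (H K : hilbertType R)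
    (pi : D -> H -> H) (rho : E -> K -> K) (i1 : D -> T) (i2 : E -> T) :
  (forall d e, i1 d * i2 e = i2 e * i1 d) ->
  min_norm pi rho i1 i2 -> min_norm rho pi i2 i1.
Proof.
move=> c mn x; have := mn (map (@swap_pair _ _) x).
rewrite tsum_swap//; congr (supremums _ _).
apply/seteqP; split=> _ [z /= z1 <-]; exists (map (@swap_pair _ _) z); rewrite /= ?tnorm_swap//.
  by rewrite -(tnorm_swap (tact _ _ _ z)) tact_swap map_swapK.
by rewrite -(tnorm_swap (tact _ _ _ z)) tact_swap.
Qed.

Section Slice.
Context {D E T : cstarAlgType R} {H K : hilbertType R}.
Context (pi : D -> H -> H) (rho : E -> K -> K) (i1 : D -> T) (i2 : E -> T).
Hypotheses (fpi : faithful_rep pi) (frho : faithful_rep rho).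
Hypotheses (hi1 : star_morph i1) (hi2 : star_morph i2).
Hypothesis mn : min_norm pi rho i1 i2.

Lemma rep_linZ (L : hilbertType R) (A : cstarAlgType R) (f : A -> L -> L) a k u :
  faithful_rep f -> f a (k *: u) = k *: f a u.
Proof.
move=> ff; have := rep_linear_op ff a => lf.
have e : f a 0 = 0.
  have := lf 1 0 0; rewrite scaler0 addr0 scale1r => e.
  by apply: (addrI (f a 0)); rewrite -e addr0.
by have := lf k u 0; rewrite e !addr0.
Qed.

Lemma rep_linD (L : hilbertType R) (A : cstarAlgType R) (f : A -> L -> L) a u v :
  faithful_rep f -> f a (u + v) = f a u + f a v.
Proof. by move=> ff; have := rep_linear_op ff a 1 u v; rewrite !scale1r. Qed.

Lemma rep_sum (L : hilbertType R) (A : cstarAlgType R) (f : A -> L -> L) a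
    I (s : seq I) (F : I -> L) :
  faithful_rep f -> f a (\sum_(i <- s) F i) = \sum_(i <- s) f a (F i).
Proof.
move=> ff; elim: s => [|i s IH].
  by rewrite !big_nil; have := rep_linZ a 0 0 ff; rewrite !scale0r.
by rewrite !big_cons rep_linD// IH.
Qed.

Lemma rep_0 (L : hilbertType R) (A : cstarAlgType R) (f : A -> L -> L) u :
  faithful_rep f -> f 0 u = 0.
Proof.
move=> ff; have := rep_linear ff 1 0 0 u; rewrite scaler0 addr0 scale1r => e.
by apply: (addrI (f 0 u)); rewrite -e addr0.
Qed.

Lemma rep_Z (L : hilbertType R) (A : cstarAlgType R) (f : A -> L -> L) k a u :
  faithful_rep f -> f (k *: a) u = k *: f a u.
Proof. by move=> ff; have := rep_linear ff k a 0 u; rewrite rep_0// !addr0. Qed.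

Lemma rep_D (L : hilbertType R) (A : cstarAlgType R) (f : A -> L -> L) a b u :
  faithful_rep f -> f (a + b) u = f a u + f b u.
Proof. by move=> ff; have := rep_linear ff 1 a b u; rewrite !scale1r. Qed.

Lemma rep_suml (L : hilbertType R) (A : cstarAlgType R) (f : A -> L -> L)
    I (s : seq I) (F : I -> A) u :
  faithful_rep f -> f (\sum_(i <- s) F i) u = \sum_(i <- s) f (F i) u.
Proof.
move=> ff; elim: s => [|i s IH]; first by rewrite !big_nil rep_0.
by rewrite !big_cons rep_D// IH.
Qed.

Lemma rep_unit_vector (L : hilbertType R) (A : cstarAlgType R) (f : A -> L -> L) :
  faithful_rep f -> exists u : L, hsq u = 1.
Proof.
move=> ff; have [v v0] : exists v : L, v != 0.
  apply: contrapT => /forallNP h.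
  have /(rep_inj ff)/eqP : f 1 = f 0.
    by apply/funext => v; rewrite (rep1 ff) rep_0//; apply/eqP/negPn/negP/h.
  by rewrite oner_eq0.
have h0 : 0 < hsq v by rewrite lt_neqAle hsq_ge0 eq_sym hsq_eq0 v0.
exists ((Num.sqrt (hsq v))^-1%:C *: v).
rewrite hsqZ cabs_real ger0_norm ?invr_ge0 ?sqrtr_ge0// exprVn sqr_sqrtr ?hsq_ge0//.
by rewrite mulVf// gt_eqF.
Qed.

Lemma tact_scale x a z : tact pi rho x (tscale a z) = tscale a (tact pi rho x z).
Proof.
rewrite /tact /tscale; elim: x => [|b x IH]//=.
rewrite map_cat IH -!map_comp; congr (_ ++ _).
by apply: eq_map => p /=; rewrite rep_linZ.
Qed.

Lemma tact_le x z : tnorm (tact pi rho x z) <= cnorm (tsum i1 i2 x) * tnorm z.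
Proof.
apply/ler_addgt0Pl => e e0; set N := cnorm _.
have N0 : 0 <= N := cn_ge0 _.
(* z is rescaled by r rather than by its own norm, which may be 0; the excess costs at most N e / (N
   + 1) <= e. *)
pose r := tnorm z + e / (N + 1).
have e1 : 0 < e / (N + 1) by rewrite divr_gt0//; lra.
have r0 : 0 < r by rewrite ltr_wpDl// tnorm_ge0.
have rz : tnorm z <= r by rewrite lerDl ltW.
have [ub _] := mn x.
have : tnorm (tact pi rho x (tscale (r^-1)%:C z)) <= N.
  apply: ub; exists (tscale (r^-1)%:C z) => //=.
  by rewrite tnorm_scale cabs_real gtr0_norm ?invr_gt0// mulrC ler_pdivrMr// mul1r.
rewrite tact_scale tnorm_scale cabs_real gtr0_norm ?invr_gt0// mulrC ler_pdivrMr//.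
move=> /le_trans; apply; rewrite /r mulrDr addrC lerD2r.
rewrite mulrCA ger_pMr// ler_pdivrMr//; lra.
Qed.

(** In coordinates for K, [pi a] (x) 1 acts separately on each of finitely many vectors of H, so an
    operator bound for [pi a] carries over. *)
Lemma rep_cn_le (a : D) c : 0 <= c -> (forall u, hsq (pi a u) <= c ^+ 2 * hsq u) ->
  cnorm (i1 a) <= c.
Proof.
move=> c0 Hc; have [_ lb] := mn [:: (a, 1)].
move: lb; rewrite /tsum big_seq1 /= (star_morph1 hi2) mulr1; apply.
move=> _ [z z1 <-]; rewrite /= in z1.
rewrite -ler_sqr ?nnegrE ?tnorm_ge0// tnorm_sqr.
apply: le_trans (_ : c ^+ 2 * tsq z <= _); last first.
  by rewrite ler_piMr ?exprn_ge0// -tnorm_sqr expr_le1 ?tnorm_ge0.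
have -> : tact pi rho [:: (a, 1)] z = [seq (pi a p.1, p.2) | p <- z].
  by rewrite /tact /= cats0; apply: eq_map => p; rewrite (rep1 frho).
have [J HJ] := gram_decomposition (map snd z).
rewrite /tsq (tinner_gram HJ) (@tinner_gram _ _ _ _ J) /=; last first.
  by move=> u v; rewrite -map_comp; apply: HJ.
rewrite mulr_sumr; apply: ler_sum => k _.
rewrite big_map /=.
have -> : \sum_(p <- z) k p.2 *: pi a p.1 = pi a (\sum_(p <- z) k p.2 *: p.1).
  by rewrite rep_sum//; apply: eq_bigr => p _; rewrite rep_linZ.
exact: Hc.
Qed.

Lemma rep_le_cn (a : D) u : hsq (pi a u) <= cnorm (i1 a) ^+ 2 * hsq u.
Proof.
have [v v1] := rep_unit_vector frho.
have := tact_le [:: (a, 1)] [:: (u, v)].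
rewrite /tsum big_seq1 /= (star_morph1 hi2) mulr1.
rewrite -ler_sqr ?nnegrE ?mulr_ge0 ?tnorm_ge0 ?cn_ge0// exprMn !tnorm_sqr.
by rewrite /tact /= (rep1 frho) !tsq1 v1 !mulr1.
Qed.

Lemma tensor_leg_inj : injective i1.
Proof.
suff k0 a : i1 a = 0 -> a = 0.
  by move=> a b e; apply/eqP; rewrite -subr_eq0; apply/eqP/k0; rewrite (smorphB hi1) e subrr.
move=> a0; apply: (rep_inj fpi); apply/funext => u.
rewrite rep_0//; apply/eqP; rewrite -hsq_eq0 eq_le hsq_ge0 andbT.
by apply: le_trans (rep_le_cn a u) _; rewrite a0 cn0 expr0n mul0r.
Qed.

Lemma tensor_leg_cn a : cnorm (i1 a) = cnorm a.
Proof. exact: (smorph_isometry hi1 tensor_leg_inj). Qed.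

(* [id (x) phi]. *)
Definition slice (phi : E -> R[i]) (x : seq (D * E)) : D :=
  \sum_(a <- x) phi a.2 *: a.1.

Definition vform (v w : K) : E -> R[i] := fun e => inner (rho e v) w.

Lemma slice_inner v w x (u u' : H) :
  inner (pi (slice (vform v w) x) u) u' = tinner (tact pi rho x [:: (u, v)]) [:: (u', w)].
Proof.
rewrite /slice rep_suml// inner_suml /tinner /tact.
rewrite big_allpairs_dep /=; apply: eq_bigr => a _.
by rewrite !big_seq1 rep_Z// innerZl mulrC.
Qed.

(** Cauchy-Schwarz for x (u (x) v) against (d u) (x) w bounds the fourth power of the norm of d u;
    one factor [Q] then cancels. *)
Lemma slice_cn v w x : cnorm (slice (vform v w) x) <=
  cnorm (tsum i1 i2 x) * Num.sqrt (hsq v) * Num.sqrt (hsq w).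
Proof.
set d := slice _ _; rewrite -tensor_leg_cn; set N := cnorm (tsum _ _ _).
have N0 : 0 <= N by apply: cn_ge0.
apply: rep_cn_le; first by rewrite !mulr_ge0 ?sqrtr_ge0.
move=> u; rewrite !exprMn !sqr_sqrtr ?hsq_ge0//.
set Q := hsq (pi d u).
have [Q0|Q0] := eqVneq Q 0; first by rewrite Q0 !mulr_ge0 ?exprn_ge0 ?hsq_ge0.
have {}Q0 : 0 < Q by rewrite lt_neqAle hsq_ge0 eq_sym Q0.
have [w0|w0] := eqVneq (hsq w) 0.
  have : inner (pi d u) (pi d u) = 0.
    move/eqP: w0; rewrite hsq_eq0 => /eqP w0.
    by rewrite /d slice_inner w0 /tinner big1// => p _; rewrite big_seq1 inner0r mulr0.
  by rewrite inner_hsq => /complexI /eqP; rewrite gt_eqF.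
have {}w0 : 0 < hsq w by rewrite lt_neqAle hsq_ge0 eq_sym w0.
have := @tinner_cauchy _ _ _ (tact pi rho x [:: (u, v)]) [:: (pi d u, w)].
rewrite tsq1 mulr_gt0// => /(_ isT).
rewrite -slice_inner -/d inner_hsq cabs_real real_normK ?num_real// -/Q.
have : tsq (tact pi rho x [:: (u, v)]) <= N ^+ 2 * (hsq u * hsq v).
  rewrite -tsq1 -!tnorm_sqr -exprMn ler_sqr ?nnegrE ?mulr_ge0 ?tnorm_ge0//.
  exact: tact_le.
set S := tsq _ => hS hQ.
have : Q ^+ 2 <= (N ^+ 2 * (hsq u * hsq v)) * (Q * hsq w).
  by apply: le_trans hQ _; rewrite ler_pM2r// mulr_gt0.
rewrite expr2 mulrCA ler_pM2l// => /le_trans; apply.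
rewrite le_eqVlt; apply/orP; left; apply/eqP; ring.
Qed.

End Slice.
End Tact.
(** * Commuting pairs of homomorphisms and the minimal norm *)

Section ListTensor.
Context {R : realType}.
Context {D E T : cstarAlgType R}.
Implicit Types (x y : seq (D * E)).

(** Operations of the algebraic tensor product on representing lists; they become those of a
    star-algebra only after evaluation, as by [tsum]. *)
Definition lmul x y : seq (D * E) := [seq (a.1 * b.1, a.2 * b.2) | a <- x, b <- y].
Definition lstar x : seq (D * E) := [seq (star a.1, star a.2) | a <- x].
Definition lscale (k : R[i]) x : seq (D * E) := [seq (k *: a.1, a.2) | a <- x].

Context (j1 : D -> T) (j2 : E -> T).
Hypotheses (h1 : star_morph j1) (h2 : star_morph j2).
Hypothesis com : forall d e, j1 d * j2 e = j2 e * j1 d.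

Lemma tsum_cat x y : tsum j1 j2 (x ++ y) = tsum j1 j2 x + tsum j1 j2 y.
Proof. by rewrite /tsum big_cat. Qed.

Lemma tsum_lscale k x : tsum j1 j2 (lscale k x) = k *: tsum j1 j2 x.
Proof.
rewrite /tsum big_map scaler_sumr; apply: eq_bigr => a _.
by rewrite (smorphZ h1) scalerAl.
Qed.

Lemma tsum_lmul x y : tsum j1 j2 (lmul x y) = tsum j1 j2 x * tsum j1 j2 y.
Proof.
rewrite /tsum big_allpairs_dep /= mulr_suml; apply: eq_bigr => a _.
rewrite mulr_sumr; apply: eq_bigr => b _.
by rewrite (star_morphM h1) (star_morphM h2) mulrA -(mulrA (j1 a.1)) com !mulrA.
Qed.

Lemma tsum_lstar x : tsum j1 j2 (lstar x) = star (tsum j1 j2 x).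
Proof.
rewrite /tsum big_map star_sum; apply: eq_bigr => a _.
by rewrite starM -(star_morph_star h1) -(star_morph_star h2) com.
Qed.

Lemma tsum1 (d : D) (e : E) : tsum j1 j2 [:: (d, e)] = j1 d * j2 e.
Proof. by rewrite /tsum big_seq1. Qed.

End ListTensor.

Section InnerCauchy.
Context {R : realType}.
Lemma inner_cauchy (H : hilbertType R) (u v : H) :
  cabs (inner u v) ^+ 2 <= hsq u * hsq v.
Proof.
have [->|v0] := eqVneq v 0; first by rewrite inner0r cabs0 expr0n mulr_ge0 ?hsq_ge0.
have h0 : 0 < hsq v by rewrite lt_neqAle hsq_ge0 eq_sym hsq_eq0 v0.
have := @tinner_cauchy _ _ _ [:: (u, v)] [:: (v, v)].
rewrite !tsq1 mulr_gt0// => /(_ isT).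
rewrite /tinner !big_seq1 /= inner_hsq cabsM cabs_real ger0_norm ?hsq_ge0// exprMn.
by rewrite -(expr2 (hsq v)) ler_pM2r// exprn_gt0.
Qed.
End InnerCauchy.

Section Psi.
Context {R : realType}.
Local Open Scope complex_scope.
Context {D T C : cstarAlgType R} {H K : hilbertType R}.
Context (pi : D -> H -> H) (rho : D -> K -> K) (i1 i2 : D -> T).
Hypotheses (fpi : faithful_rep pi) (frho : faithful_rep rho).
Hypotheses (hi1 : star_morph i1) (hi2 : star_morph i2).
Hypothesis icom : forall d e, i1 d * i2 e = i2 e * i1 d.
Hypothesis mn : min_norm pi rho i1 i2.
Context (f h : D -> C).
Hypotheses (hf : star_morph f) (hh : star_morph h).
Hypothesis fcom : forall d e, f d * h e = h e * f d.
Variable eta : K.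
Hypothesis eta1 : hsq eta = 1.
Implicit Types (w x y : seq (D * D)) (d : D).

Let t := tsum i1 i2.
Let M := tsum f h.

(* [phi (x) id], for the vector functional [phi] given by [v] and [v'] in the
   representation of the other leg. *)
Definition slice2 (v v' : K) x : D := \sum_(m <- x) inner (rho m.1 v) v' *: m.2.

(* The functional lives in [rho], whereas the minimal norm uses [pi] on that leg;
   exchanging the two slices reduces the bound to [slice_cn]. *)
Lemma slice2_cn v v' x : cnorm (slice2 v v' x) <=
  cnorm (t x) * Num.sqrt (hsq v) * Num.sqrt (hsq v').
Proof.
set d := slice2 v v' x; set N := cnorm (t x).
have N0 : 0 <= N by apply: cn_ge0.
have icom' d1 d2 : i2 d1 * i1 d2 = i1 d2 * i2 d1 by rewrite icom.
have mns := min_norm_swap icom mn.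
rewrite -(tensor_leg_cn frho fpi hi2 hi1 mns).
apply: (rep_cn_le frho fpi hi1 mns); first by rewrite !mulr_ge0 ?sqrtr_ge0.
move=> u; rewrite !exprMn !sqr_sqrtr ?hsq_ge0//.
set Q := hsq (rho d u).
have Q0 : 0 <= Q by apply: hsq_ge0.
pose e := slice (vform rho u (rho d u)) x.
have QE u' : inner (rho d u) u' = inner (rho (slice (vform rho u u') x) v) v'.
  rewrite /d /slice /slice2 !(rep_suml _ _ _ frho) !inner_suml.
  by apply: eq_bigr => m _; rewrite !(rep_Z _ _ _ frho) !innerZl mulrC.
have := inner_cauchy (rho e v) v'; rewrite /e -QE -/e inner_hsq -/Q cabs_real ger0_norm//.
have hE : hsq (rho e v) <= (N ^+ 2 * hsq u * Q) * hsq v.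
  apply: le_trans (rep_le_cn frho fpi hi1 mns _ _) _.
  rewrite ler_wpM2r ?hsq_ge0// (tensor_leg_cn frho fpi hi2 hi1 mns).
  have hs := slice_cn fpi frho hi1 hi2 mn u (rho d u) x.
  have : cnorm e ^+ 2 <= (N * Num.sqrt (hsq u) * Num.sqrt (hsq (rho d u))) ^+ 2.
    by rewrite ler_sqr ?nnegrE ?mulr_ge0 ?sqrtr_ge0 ?cn_ge0.
  by rewrite !exprMn !sqr_sqrtr ?hsq_ge0.
move=> h1.
have h2 : Q ^+ 2 <= N ^+ 2 * hsq u * Q * hsq v * hsq v'.
  by apply: le_trans h1 _; rewrite ler_wpM2r ?hsq_ge0.
have [->|Q1] := eqVneq Q 0; first by rewrite !mulr_ge0 ?exprn_ge0 ?hsq_ge0.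
have {}Q1 : 0 < Q by rewrite lt_neqAle Q0 eq_sym Q1.
rewrite -(ler_pM2l Q1) -expr2; apply: le_trans h2 _.
rewrite le_eqVlt; apply/orP; left; apply/eqP; ring.
Qed.

(* For [phi] the vector state of [eta], [d |-> (id (x) phi) (w^* (1 (x) d) w)] is a
   completely positive finite rank map, close to the identity when [w] is close to
   a half-flip; [Psi w] is this map on the first leg, followed by [f (x) h]. It is
   positive for the minimal norm, being a compression of [rho (x) h]. *)
Definition Psi w x : C := \sum_(p <- w) \sum_(q <- w) \sum_(m <- x)
  inner (rho (m.1 * q.2) eta) (rho p.2 eta) *: (star (f p.1) * h m.2 * f q.1).

Lemma Psi_cat w x y : Psi w (x ++ y) = Psi w x + Psi w y.
Proof.
rewrite /Psi -big_split; apply: eq_bigr => p _; rewrite -big_split.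
by apply: eq_bigr => q _; rewrite big_cat.
Qed.

Lemma Psi_scale w k x : Psi w (lscale k x) = k *: Psi w x.
Proof.
rewrite /Psi scaler_sumr; apply: eq_bigr => p _; rewrite scaler_sumr.
apply: eq_bigr => q _; rewrite big_map scaler_sumr; apply: eq_bigr => m _ /=.
by rewrite -scalerAl (rep_Z _ _ _ frho) innerZl scalerA.
Qed.

(** A Gram decomposition of the vectors [rho (m.1 * p.2) eta], for p in w and m in x, turns the sum
    into a finite sum of elements star G * G. *)
Lemma Psi_star_mul w x : cpos (Psi w (lmul (lstar x) x)).
Proof.
pose P := [seq (p, m) | p <- w, m <- x].
pose v (s : (D * D) * (D * D)) := rho (s.2.1 * s.1.2) eta.
pose g (s : (D * D) * (D * D)) := h s.2.2 * f s.1.1.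
have [J HJ] := gram_decomposition (map v P).
suff -> : Psi w (lmul (lstar x) x) = \sum_(c <- J)
    star (\sum_(s <- P) c (v s) *: g s) * (\sum_(s <- P) c (v s) *: g s).
  exact: cpos_sum_star.
transitivity (\sum_(s <- P) \sum_(s' <- P) inner (v s') (v s) *: (star (g s) * g s')).
  rewrite /Psi big_allpairs_dep /=; apply: eq_bigr => p _.
  transitivity (\sum_(q <- w) \sum_(a <- x) \sum_(b <- x)
     inner (v (q, b)) (v (p, a)) *: (star (g (p, a)) * g (q, b))).
    apply: eq_bigr => q _; rewrite /lmul /lstar big_allpairs_dep big_map.
    apply: eq_bigr => a _; apply: eq_bigr => b _; rewrite /v /g /=.
    rewrite starM (star_morphM hh) (star_morph_star hh) !mulrA; congr (_ *: _).
    rewrite -(mulrA (star a.1)) (repM frho (star a.1)) /= (rep_star frho) starK.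
    by rewrite (repM frho a.1).
  rewrite exchange_big; apply: eq_bigr => a _.
  by rewrite big_allpairs_dep.
transitivity (\sum_(s <- P) \sum_(s' <- P) \sum_(c <- J)
   star (c (v s) *: g s) * (c (v s') *: g s')).
  apply: eq_big_seq => s sP; apply: eq_big_seq => s' s'P.
  rewrite HJ ?map_f// scaler_suml; apply: eq_bigr => c _.
  by rewrite starZ -scalerAl -scalerAr scalerA mulrC.
transitivity (\sum_(s <- P) \sum_(c <- J) \sum_(s' <- P)
   star (c (v s) *: g s) * (c (v s') *: g s')).
  by apply: eq_bigr => s _; rewrite exchange_big.
rewrite exchange_big /=; apply: eq_bigr => c _.
rewrite star_sum mulr_suml; apply: eq_bigr => s _.
by rewrite mulr_sumr.
Qed.

Let phi := vform rho eta eta.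

Lemma slice_phi_cn x : cnorm (slice phi x) <= cnorm (t x).
Proof.
apply: le_trans (slice_cn fpi frho hi1 hi2 mn _ _ _) _.
by rewrite eta1 sqrtr1 !mulr1.
Qed.

Lemma Psi_one w : Psi w [:: (1, 1)] = f (slice phi (lmul (lstar w) w)).
Proof.
rewrite /Psi /slice (smorph_sum hf) /lmul /lstar big_allpairs_dep big_map.
apply: eq_bigr => p _; apply: eq_bigr => q _; rewrite big_seq1 /=.
rewrite (smorphZ hf) (star_morphM hf) (star_morph_star hf) (star_morph1 hh) mulr1 mul1r.
by congr (_ *: _); rewrite /phi /vform (repM frho) /= [RHS](rep_star frho) starK.
Qed.

Lemma Psi_one_cn w : cnorm (t w) <= 1 -> cnorm (Psi w [:: (1, 1)]) <= 1.
Proof.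
move=> w1; rewrite Psi_one; apply: le_trans (smorph_cn hf _) _.
apply: le_trans (slice_phi_cn _) _.
by rewrite /t (tsum_lmul hi1 hi2 icom) (tsum_lstar hi1 hi2 icom) cnorm_starM expr_le1 ?cn_ge0.
Qed.

(** The constant depends on w without control, so it may only multiply errors chosen after w. *)
Lemma Psi_bounded w : exists2 c, 0 <= c & forall x, cnorm (Psi w x) <= c * cnorm (t x).
Proof.
pose cf p q : R := cnorm (star (f p.1)) *
  (Num.sqrt (hsq (rho q.2 eta)) * Num.sqrt (hsq (rho p.2 eta))) * cnorm (f q.1).
have cf0 p q : 0 <= cf p q by rewrite !mulr_ge0 ?sqrtr_ge0 ?cn_ge0.
exists (\sum_(p <- w) \sum_(q <- w) cf p q).
  by apply: sumr_ge0 => p _; apply: sumr_ge0 => q _; apply: cf0.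
move=> x; rewrite mulr_suml; apply: le_trans (ler_cn_sum _ _) _.
apply: ler_sum => p _; rewrite mulr_suml; apply: le_trans (ler_cn_sum _ _) _.
apply: ler_sum => q _.
have -> : \sum_(m <- x) inner (rho (m.1 * q.2) eta) (rho p.2 eta) *:
      (star (f p.1) * h m.2 * f q.1) =
    star (f p.1) * h (slice2 (rho q.2 eta) (rho p.2 eta) x) * f q.1.
  rewrite /slice2 (smorph_sum hh) mulr_sumr mulr_suml; apply: eq_bigr => m _.
  by rewrite (repM frho) /= (smorphZ hh) -scalerAr -scalerAl.
have -> : cf p q * cnorm (t x) = cnorm (star (f p.1)) *
    (cnorm (t x) * Num.sqrt (hsq (rho q.2 eta)) * Num.sqrt (hsq (rho p.2 eta))) * cnorm (f q.1).
  rewrite /cf; ring.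
apply: ler_cnM => //; apply: ler_cnM => //.
by apply: le_trans (smorph_cn hh _) _; apply: slice2_cn.
Qed.

Definition flipd w d := lmul (lstar w) (lmul [:: (1, d)] w).

Lemma Psi_slice w x :
  Psi w x = \sum_(m <- x) f (slice phi (flipd w m.1)) * h m.2.
Proof.
rewrite /Psi; transitivity (\sum_(m <- x) \sum_(p <- w) \sum_(q <- w)
  inner (rho (m.1 * q.2) eta) (rho p.2 eta) *: (star (f p.1) * h m.2 * f q.1)).
  rewrite [RHS]exchange_big /=; apply: eq_bigr => p _; exact: exchange_big.
apply: eq_bigr => m _.
rewrite /slice (smorph_sum hf) /flipd /lmul /lstar big_allpairs_dep big_map mulr_suml.
apply: eq_bigr => p _; rewrite /= cats0 big_map mulr_suml; apply: eq_bigr => q _ /=.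
rewrite mul1r (smorphZ hf) (star_morphM hf) (star_morph_star hf) -scalerAl.
rewrite -mulrA -fcom mulrA; congr (_ *: _).
by rewrite /phi /vform (repM frho (star p.2)) /= [RHS](rep_star frho) starK.
Qed.

Lemma slice_phi_leg d : slice phi [:: (d, 1)] = d.
Proof.
by rewrite /slice big_seq1 /= /phi /vform (rep1 frho) inner_hsq eta1 scale1r.
Qed.

Lemma slice_phi_cat x y : slice phi (x ++ y) = slice phi x + slice phi y.
Proof. by rewrite /slice big_cat. Qed.

Lemma slice_phi_scale k x : slice phi (lscale k x) = k *: slice phi x.
Proof.
rewrite /slice big_map scaler_sumr; apply: eq_bigr => a _ /=.
by rewrite !scalerA mulrC.
Qed.

(** Slicing d (x) 1 by a state returns d, and w^* (1 (x) d) w is close to d (x) 1 because w nearly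
    implements the flip. *)
Lemma Psi_approx w x e :
  (forall d, d \in map fst x -> cnorm (i1 d - star (t w) * i2 d * t w) <= e) ->
  cnorm (M x - Psi w x) <= e * \sum_(m <- x) cnorm m.2.
Proof.
move=> He; rewrite Psi_slice /M /tsum -sumrB mulr_sumr.
apply: le_trans (ler_cn_sum _ _) _.
rewrite big_seq [leRHS]big_seq; apply: ler_sum => m mx.
rewrite -mulrBl; apply: ler_cnM; last exact: smorph_cn.
rewrite -(smorphB hf); apply: le_trans (smorph_cn hf _) _.
have -> : m.1 - slice phi (flipd w m.1) =
    slice phi ([:: (m.1, 1)] ++ lscale (-1) (flipd w m.1)).
  by rewrite slice_phi_cat slice_phi_leg slice_phi_scale scaleN1r.
apply: le_trans (slice_phi_cn _) _.
rewrite /t tsum_cat (tsum_lscale _ hi1) scaleN1r tsum1 (star_morph1 hi2) mulr1.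
rewrite /flipd !(tsum_lmul hi1 hi2 icom) (tsum_lstar hi1 hi2 icom) tsum1.
rewrite (star_morph1 hi1) mul1r mulrA; apply: He.
by rewrite map_f.
Qed.

Hypothesis dense : forall s e, 0 < e -> exists x, cnorm (s - t x) < e.

Lemma dense_square (s : T) e : 0 < e ->
  exists x, cnorm (star s * s - star (t x) * t x) <= e.
Proof.
move=> e0; have s0 := cn_ge0 s.
pose r := Num.min 1 (e / (2 * cnorm s + 1)).
have D0 : 0 < 2 * cnorm s + 1 by lra.
have r0 : 0 < r by rewrite lt_min ltr01 divr_gt0.
have [x /ltW hx] := dense s r0; exists x.
have r1 : r <= 1 by rewrite ge_min lexx.
have r2 : r * (2 * cnorm s + 1) <= e by rewrite -ler_pdivlMr// ge_min lexx orbT.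
have nx : cnorm (t x) <= cnorm s + 1.
  rewrite -(subrK s (t x)) addrC; apply: ler_cnD => //; rewrite cnB.
  exact: le_trans r1.
have -> : star s * s - star (t x) * t x = star s * (s - t x) + star (s - t x) * t x.
  by rewrite starB mulrBr mulrBl addrA subrK.
apply: le_trans (ler_cnD (ler_cnM (lexx _) hx) (ler_cnM (lexx _) nx)) _.
rewrite !cn_star; apply: le_trans r2.
have := cn_ge0 (s - t x); nra.
Qed.

Hypothesis flip : forall (ds : seq D) e, 0 < e -> exists w, cnorm (t w) <= 1 /\
  forall d, d \in ds -> cnorm (i1 d - star (t w) * i2 d * t w) <= e.

(** By the C*-identity it suffices to bound M at X = x^* x, where it is close to [Psi w X].
    Positivity allows adding [Psi w X'], and X + X' is close to 1, where [Psi w] has norm at most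
    1. *)
Lemma tsum_cn_le1 x : cnorm (t x) <= 1 -> cnorm (M x) <= 1.
Proof.
move=> x1; rewrite -(@expr_le1 _ 2) ?cn_ge0//.
apply/ler_addgt0Pl => e e0.
pose X := lmul (lstar x) x.
have MX : M X = star (M x) * M x.
  by rewrite /M (tsum_lmul hf hh fcom) (tsum_lstar hf hh fcom).
rewrite -cnorm_starM -MX.
pose S := \sum_(m <- X) cnorm m.2.
have S0 : 0 <= S by apply: sumr_ge0 => m _; apply: cn_ge0.
have [w [w1 hw]] := flip (map fst X) (ltac:(apply: divr_gt0; lra) : 0 < e / (2 * (S + 1))).
have hM := Psi_approx hw.
(* The order of choices matters: w depends on X and e, c on w, and only then is e' made small
   against c. *)
have [c c0 hc] := Psi_bounded w.
pose e' := e / (4 * (c + 1)).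
have e'0 : 0 < e' by apply: divr_gt0; lra.
have e'c : c * (e' + e') <= e / 2.
  have -> : e' + e' = e / 2 / (c + 1) by rewrite /e'; field; rewrite gt_eqF//; lra.
  rewrite mulrCA ger_pMr; last lra.
  rewrite ler_pdivrMr; lra.
have [s hs] := approx_sqrt_compl x1 e'0.
have [x' hx'] := dense_square s e'0.
pose X' := lmul (lstar x') x'.
(* Represents 1 - x^* x - x'^* x', which is small for the minimal norm though not zero. *)
pose del := [:: (1, 1)] ++ lscale (-1) X ++ lscale (-1) X'.
have tdel : cnorm (t del) <= e' + e'.
  rewrite /del /t !tsum_cat !(tsum_lscale _ hi1) !scaleN1r.
  rewrite !(tsum_lmul hi1 hi2 icom) !(tsum_lstar hi1 hi2 icom) tsum1.
  rewrite (star_morph1 hi1) (star_morph1 hi2) mul1r addrA.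
  by rewrite -(subrKA (star s * s)); apply: ler_cnD.
have hdel : cnorm (Psi w del) <= e / 2.
  by apply: le_trans (hc _) _; apply: le_trans e'c; rewrite ler_wpM2l.
have pX : cnorm (Psi w X) <= 1 + e / 2.
  apply: le_trans (cn_le_cpos (Psi_star_mul w x) (Psi_star_mul w x')) _.
  have -> : Psi w X + Psi w X' = Psi w [:: (1, 1)] - Psi w del.
    by rewrite /del !Psi_cat !Psi_scale !scaleN1r opprD addrA subrr add0r opprD !opprK.
  by apply: ler_cnB => //; apply: Psi_one_cn.
rewrite -(subrK (Psi w X) (M X)).
have -> : e + 1 = e / 2 + (1 + e / 2) by field.
apply: ler_cnD => //; apply: le_trans hM _.
rewrite -/S mulrAC ler_pdivrMr; last lra.
nra.
Qed.

Lemma tsum_cn_le x : cnorm (M x) <= cnorm (t x).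
Proof.
apply/ler_addgt0Pr => e e0.
set r := _ + e.
have r0 : 0 < r by rewrite /r; have := cn_ge0 (t x); lra.
have := @tsum_cn_le1 (lscale (r^-1)%:C x).
rewrite /t /M (tsum_lscale _ hi1) (tsum_lscale _ hf) !cn_realZ gtr0_norm ?invr_gt0//.
rewrite ![r^-1 * _]mulrC !ler_pdivrMr// !mul1r; apply.
by rewrite lerDl ltW.
Qed.

End Psi.

(** * Approximate conjugation of commuting homomorphisms *)

Section HalfFlip.
Context {R : realType}.
Context {D : cstarAlgType R}.

Lemma unitary_cn (A : cstarAlgType R) (u : A) : unitary u -> cnorm u = 1.
Proof.
move=> [h _]; have := cnorm_starM u; rewrite h cn1 => /esym/eqP.
by rewrite sqrp_eq1 ?cn_ge0// => /eqP.
Qed.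

(** An e/2-approximant has norm at most 1 + e/2; dividing by this number costs at most another
    e/2. *)
Lemma approx_unitary_in_dense (A : cstarAlgType R) (X : Type) (t : X -> A)
    (sc : R[i] -> X -> X) (u : A) (e : R) :
  (forall k x, t (sc k x) = k *: t x) ->
  (forall s e, 0 < e -> exists x, cnorm (s - t x) < e) ->
  cnorm u <= 1 -> 0 < e -> exists x, cnorm (t x) <= 1 /\ cnorm (t x - u) <= e.
Proof.
move=> tsc dense u1 e0; have e2 : 0 < e / 2 by lra.
have [x /ltW hx] := dense u _ e2.
have nx : cnorm (t x) <= e / 2 + 1.
  by rewrite -(subrK u (t x)); apply: ler_cnD => //; rewrite cnB.
pose k := (1 + e / 2)^-1.
have k0 : 0 < k by rewrite invr_gt0; lra.
have k1 : k * (1 + e / 2) = 1 by rewrite mulVf// gt_eqF//; lra.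
exists (sc k%:C%C x); rewrite tsc; split.
  by rewrite cn_realZ gtr0_norm// -k1 ler_pM2l// addrC.
have -> : k%:C%C *: t x - u = k%:C%C *: (t x - u) - (1 - k)%:C%C *: u.
  by rewrite scalerBr rmorphB scalerBl scale1r opprB addrA subrK.
have k2 : k <= 1 by nra.
have -> : e = e / 2 + e / 2 by field.
apply: ler_cnB; rewrite cn_realZ.
  rewrite gtr0_norm// cnB; apply: le_trans hx.
  by rewrite ler_piMl ?cn_ge0.
rewrite ger0_norm ?subr_ge0//; have := cn_ge0 u; nra.
Qed.

Lemma half_flip_approx (T : cstarAlgType R) (i1 i2 : D -> T)
    (I : Type) (le : I -> I -> Prop) (u : I -> T) :
  star_morph i1 -> star_morph i2 ->
  (forall s e, 0 < e -> exists x, cnorm (s - tsum i1 i2 x) < e) ->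
  directed le -> (forall l, unitary (u l)) ->
  (forall (d : D) (eps : R), 0 < eps -> exists l0, forall l, le l0 l ->
      cnorm (u l * i1 d * star (u l) - i2 d) < eps) ->
  forall (ds : seq D) e, 0 < e -> exists w, let v := tsum i1 i2 w in
    [/\ cnorm v <= 1, cnorm (star v * v - 1) <= e, cnorm (v * star v - 1) <= e
      & forall d, d \in ds -> cnorm (v * i1 d - i2 d * v) <= e /\
                              cnorm (i1 d - star v * i2 d * v) <= e].
Proof.
move=> hi1 hi2 dense [[l0] lerefl letrans ledir] uu conv ds e e0.
have e4 : 0 < e / 4 by lra.
have [l Hl] : exists l, forall d, d \in ds -> cnorm (u l * i1 d * star (u l) - i2 d) <= e / 4.
  suff [l Hl] : exists l, forall l', le l l' -> forall d, d \in ds ->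
      cnorm (u l' * i1 d * star (u l') - i2 d) <= e / 4.
    by exists l; apply: Hl.
  elim: ds => [|d ds [l Hl]]; first by exists l0.
  have [l1 H1] := conv d _ e4; have [k [lk l1k]] := ledir l l1.
  exists k => l' kl' d'; rewrite inE => /orP[/eqP->|].
    by apply: ltW; apply: H1; apply: letrans kl'.
  by apply: Hl; apply: letrans kl'.
pose N := \sum_(d <- ds) cnorm d.
have N0 : 0 <= N by apply: sumr_ge0 => d _; apply: cn_ge0.
have leN d : d \in ds -> cnorm d <= N.
  by move=> dds; rewrite /N (big_rem d)//= lerDl; apply: sumr_ge0 => ? _; apply: cn_ge0.
(* One precision for all of [ds]: every error below is at most 4 n N + e / 4 or 2 n, and 8 (n N + n)
   = e. *)
pose n := e / (8 * (N + 1)).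
have n0 : 0 < n by rewrite divr_gt0//; lra.
have nN : 8 * (n * N + n) = e by rewrite /n; field; rewrite gt_eqF//; lra.
have nN0 : 0 <= n * N by rewrite mulr_ge0// ltW.
have u1 := unitary_cn (uu l); have u1' : cnorm (u l) <= 1 by rewrite u1.
have [w [w1 wu]] := approx_unitary_in_dense (tsum_lscale i2 hi1) dense u1' n0.
exists w => /=; set v := tsum i1 i2 w in w1 wu *; set U := u l in u1 wu Hl *.
have [U1 U2] := uu l; rewrite -/U in U1 U2.
have sU : cnorm (star U) <= 1 by rewrite cn_star u1.
have sv : cnorm (star v) <= 1 by rewrite cn_star.
have svU : cnorm (star v - star U) <= n by rewrite -starB cn_star.
have h1 : cnorm (star v * v - 1) <= n + n.
  have -> : star v * v - 1 = star v * (v - U) + (star v - star U) * U.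
    by rewrite mulrBr mulrBl U1 addrA subrK.
  by apply: ler_cnD; [rewrite -[n]mul1r|rewrite -[n]mulr1]; apply: ler_cnM; rewrite ?u1.
have h2 : cnorm (v * star v - 1) <= n + n.
  have -> : v * star v - 1 = v * (star v - star U) + (v - U) * star U.
    by rewrite mulrBr mulrBl U2 addrA subrK.
  by apply: ler_cnD; [rewrite -[n]mul1r|rewrite -[n]mulr1]; apply: ler_cnM.
split=> //; [lra|lra|] => d dds.
have d1 : cnorm (i1 d) <= N by apply: le_trans (smorph_cn hi1 d) (leN _ dds).
have d2 : cnorm (i2 d) <= N by apply: le_trans (smorph_cn hi2 d) (leN _ dds).
have h3 : cnorm (v * i1 d - i2 d * v) <= n * N + N * n + e / 4.
  have -> : v * i1 d - i2 d * v = (v - U) * i1 d - i2 d * (v - U) + (U * i1 d * star U - i2 d) * U.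
    rewrite !mulrBl mulrBr -(mulrA _ (star U)) U1 mulr1 opprB.
    by rewrite addrAC !subrKA.
  apply: ler_cnD; first by apply: ler_cnB; apply: ler_cnM.
  by rewrite -[e / 4]mulr1; apply: ler_cnM; rewrite ?u1//; apply: Hl.
split; first by lra.
have -> : i1 d - star v * i2 d * v =
    star v * (v * i1 d - i2 d * v) - (star v * v - 1) * i1 d.
  by rewrite mulrBr mulrBl mul1r !mulrA opprB [RHS]addrC subrKA.
have : cnorm (star v * (v * i1 d - i2 d * v) - (star v * v - 1) * i1 d) <=
    1 * (n * N + N * n + e / 4) + (n + n) * N.
  by apply: ler_cnB; apply: ler_cnM.
move=> /le_trans; apply; lra.
Qed.

(** Each relation bounds the norm of an explicit tensor, so [tsum_cn_le] transports it from the
    half-flip to C. Keeping v as [tsum f h w] ensures that it commutes with whatever commutes with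
    both ranges. *)
Lemma commuting_pair_approx (C : cstarAlgType R) (f h : D -> C) :
  approx_inner_half_flip D -> star_morph f -> star_morph h ->
  (forall d e, f d * h e = h e * f d) ->
  forall (ds : seq D) e, 0 < e -> exists w, let v := tsum f h w in
    [/\ cnorm v <= 1, cnorm (star v * v - 1) <= e, cnorm (v * star v - 1) <= e
      & forall d, d \in ds -> cnorm (v * f d - h d * v) <= e].
Proof.
move=> [T [i1' [i2' [[si1 si2 icom dens [H [K [pi [rho [fpi frho mn]]]]]]]]]].
move=> [I [le [u [dir uu conv]]]] hf hh fcom.
have hi1 := star_hom_morph si1; have hi2 := star_hom_morph si2.
set i1 : D -> T := i1' in hi1 icom dens mn conv.
set i2 : D -> T := i2' in hi2 icom dens mn conv.
have {}dens s e : 0 < e -> exists x, cnorm (s - tsum i1 i2 x) < e.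
  move=> e0; have : norm_closure (range (tsum i1 i2)) s by rewrite dens.
  by move=> /(_ e e0)[_ [x _ <-] hx]; exists x.
have [eta eta1] := rep_unit_vector frho.
have appr := half_flip_approx hi1 hi2 dens dir uu conv.
have flip (ds : seq D) e : 0 < e -> exists w, cnorm (tsum i1 i2 w) <= 1 /\ forall d, d \in ds ->
    cnorm (i1 d - star (tsum i1 i2 w) * i2 d * tsum i1 i2 w) <= e.
  by move=> /(appr ds)[w [w1 _ _ hw]]; exists w; split=> // d /hw[].
have key := tsum_cn_le fpi frho hi1 hi2 icom mn hf hh fcom eta1 dens flip.
move=> ds e /(appr ds)[w [w1 w2 w3 hw]]; exists w => /=; split.
- exact: le_trans (key w) w1.
- have := key (lmul (lstar w) w ++ lscale (-1) [:: (1, 1)]).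
  rewrite !tsum_cat !(tsum_lscale _ hi1) !(tsum_lscale _ hf) !scaleN1r !tsum1.
  rewrite !(tsum_lmul hi1 hi2 icom) !(tsum_lmul hf hh fcom).
  rewrite (tsum_lstar hi1 hi2 icom) (tsum_lstar hf hh fcom).
  rewrite !(star_morph1 hi1, star_morph1 hi2, star_morph1 hf, star_morph1 hh) !mul1r.
  by move=> /le_trans; apply.
- have := key (lmul w (lstar w) ++ lscale (-1) [:: (1, 1)]).
  rewrite !tsum_cat !(tsum_lscale _ hi1) !(tsum_lscale _ hf) !scaleN1r !tsum1.
  rewrite !(tsum_lmul hi1 hi2 icom) !(tsum_lmul hf hh fcom).
  rewrite (tsum_lstar hi1 hi2 icom) (tsum_lstar hf hh fcom).
  rewrite !(star_morph1 hi1, star_morph1 hi2, star_morph1 hf, star_morph1 hh) !mul1r.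
  by move=> /le_trans; apply.
move=> d /hw[hd _].
have := key (lmul w [:: (d, 1)] ++ lscale (-1) (lmul [:: (1, d)] w)).
rewrite !tsum_cat !(tsum_lscale _ hi1) !(tsum_lscale _ hf) !scaleN1r.
rewrite !(tsum_lmul hi1 hi2 icom) !(tsum_lmul hf hh fcom) !tsum1.
rewrite !(star_morph1 hi1, star_morph1 hi2, star_morph1 hf, star_morph1 hh) !mul1r !mulr1.
by move=> /le_trans; apply.
Qed.
End HalfFlip.
(** * Saturation *)

Section Saturation.
Context {R : realType}.
Implicit Types (C D : cstarAlgType R).

Definition mk_set_type {T : Type} (A : set T) (a : T) (Aa : A a) : set_type A :=
  exist _ a (mem_set Aa).

Definition param_val C (A : set C) (b : nat -> C) (z : set_type A + nat) : C :=
  match z with inl c => val c | inr i => b i end.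

Lemma sub_coord_continuous (r : R) : continuous (fun v : 'rV[R]_1 => v 0 0 - r).
Proof.
move=> v; apply: (@continuousB R _ _ (fun v : 'rV[R]_1 => v 0 0) (fun=> r)).
  exact: coord_continuous.
exact: cst_continuous.
Qed.

(** Saturation solves equations with right-hand side 0, so the value r is subtracted by a
    connective. *)
Definition norm_condition C (A : set C) (p : @starpoly R (set_type A + nat)) (r : R) :
    formula (set_type A) :=
  FConn (@sub_coord_continuous r) (fun=> FNorm p).

Lemma interp_norm_condition C (A : set C) p r (b : nat -> C) :
  interp [set: C] val (@norm_condition C A p r) b =
    cnorm (peval (@param_val C A b) p) - r.
Proof. by rewrite /= mxE. Qed.

(** The index type is arbitrary, since saturation restricts the parameters and not the number of
    formulas; all elements of D may therefore index conditions. *)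
Lemma saturation_poly C (A : set C) (I : Type)
    (p : I -> @starpoly R (set_type A + nat)) (r : I -> R) :
  countably_saturated [set: C] -> separable_set A ->
  (forall n (g : 'I_n -> I) (eps : R), 0 < eps ->
    exists b : nat -> C, (forall i, cnorm (b i) <= 1) /\
      forall k, `|cnorm (peval (param_val b) (p (g k))) - r (g k)| < eps) ->
  exists b : nat -> C, (forall i, cnorm (b i) <= 1) /\
    forall i, cnorm (peval (param_val b) (p i)) = r i.
Proof.
move=> sat sepA fin.
pose phi i := norm_condition (p i) (r i).
have [|S0 finS0 subS0 eps eps0|b [hb Hb]] := sat A _ sepA (range phi) => //.
  have /(@finite_seqP {classic (formula (set_type A))})[s sE] := finS0.
  have /choice[g Hg] : forall k : 'I_(size s), exists i, phi i = tnth (in_tuple s) k.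
    move=> k; have : S0 (tnth (in_tuple s) k) by rewrite sE /=; apply: mem_tnth.
    by move=> /subS0[i _ hi]; exists i.
  have [b [hb Hb]] := fin _ g eps eps0; exists b; split=> [i|f Sf].
    by split=> //=; apply: hb.
  have : (f : {classic (formula (set_type A))}) \in s by move: Sf; rewrite sE.
  move=> /(tnthP (in_tuple s))[k ->].
  by rewrite -Hg interp_norm_condition; apply: Hb.
exists b; split=> [i|i]; first by case: (hb i).
have := Hb (phi i) (imageT phi i); rewrite interp_norm_condition => /eqP.
by rewrite subr_eq0 => /eqP.
Qed.

Lemma separable_setU C (A B : set C) :
  separable_set A -> separable_set B -> separable_set (A `|` B).
Proof.
move=> [P cP [PA AP]] [Q cQ [QB BQ]]; exists (P `|` Q).
  by rewrite -bigcup2E; apply: bigcup_countable => // -[|[|?]] _.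
split; first exact: setUSS.
by move=> x [/AP|/BQ] H e /H[y hy ?]; exists y => //; [left|right].
Qed.

Lemma separable_image (D C : cstarAlgType R) (f : D -> C) (A : set D) :
  (forall x y, cnorm (f x - f y) <= cnorm (x - y)) ->
  separable_set A -> separable_set (f @` A).
Proof.
move=> fc [P cP [PA AP]]; exists (f @` P); first exact: sub_countable (card_image_le _ _) cP.
split; first exact: image_subset.
move=> _ [x Ax <-] e e0; have [y Py xy] := AP x Ax e e0.
by exists (f y); [exists y | apply: le_lt_trans xy].
Qed.

Lemma separable_countable C (A : set C) : countable A -> separable_set A.
Proof.
move=> cA; exists A => //; split=> // x Ax e e0.
by exists x; rewrite // subrr cn0.
Qed.

Lemma separable_range_seq C (b : nat -> C) : separable_set (range b).
Proof. by exact/separable_countable/(sub_countable (card_image_le _ _)). Qed.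

(** * Potential absorption *)

Fixpoint psubst (X Y : Type) (s : X -> @starpoly R Y) (p : @starpoly R X) : starpoly Y :=
  match p with
  | PVar x => s x
  | PConst a => PConst Y a
  | PAdd p q => PAdd (psubst s p) (psubst s q)
  | PMul p q => PMul (psubst s p) (psubst s q)
  | PStar p => PStar (psubst s p)
  end.

Lemma peval_psubst C (X Y : Type) (s : X -> starpoly Y) (v : Y -> C) p :
  peval v (psubst s p) = peval (fun x => peval v (s x)) p.
Proof. by elim: p => //= [p -> q ->|p -> q ->|p ->]. Qed.

Lemma eq_peval C (X : Type) (v w : X -> C) p : v =1 w -> peval v p = peval w p.
Proof. by move=> e; elim: p => //= [p -> q ->|p -> q ->|p ->]. Qed.

Fixpoint pbound (p : @starpoly R nat) : nat :=
  match p with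
  | PVar i => i.+1
  | PConst _ => 0
  | PAdd p q => maxn (pbound p) (pbound q)
  | PMul p q => maxn (pbound p) (pbound q)
  | PStar p => pbound p
  end.

Lemma peval_pbound C (v w : nat -> C) p m : (pbound p <= m)%N ->
  (forall i, (i < m)%N -> v i = w i) -> peval v p = peval w p.
Proof.
move=> pm e; elim: p pm => //= [p IHp q IHq|p IHp q IHq|p IHp].
- by rewrite geq_max => /andP[/IHp -> /IHq ->].
- by rewrite geq_max => /andP[/IHp -> /IHq ->].
- by move=> /IHp ->.
Qed.

(** Potential absorption needs polynomials in a fixed finite number of variables. The default 0 is
    never reached once m is at least [pbound p]. *)
Definition truncate (m : nat) (p : @starpoly R nat) : @starpoly R 'I_m :=
  psubst (fun i => if insub i is Some j then PVar j else PConst _ 0) p.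

Lemma peval_truncate C m (v : nat -> C) (w : 'I_m -> C) p : (pbound p <= m)%N ->
  (forall j : 'I_m, v j = w j) -> peval w (truncate m p) = peval v p.
Proof.
move=> pm e; rewrite peval_psubst; apply: (peval_pbound pm) => i im.
by rewrite insubT; exact: esym (e (Ordinal im)).
Qed.

Lemma absorbing_approx C D : potentially_absorbing D C ->
  forall (n : nat) (p : 'I_n -> starpoly 'I_n) (d : 'I_n -> D) (x : 'I_n -> C) eps,
    (0 < n)%N -> tuple_ball d -> tuple_ball x -> 0 < eps ->
    exists y : 'I_n -> C, [/\ tuple_ball y,
      forall i j, cnorm (x i * y j - y j * x i) < eps &
      forall j, `|cnorm (peval d (p j)) - cnorm (peval y (p j))| < eps].
Proof.
move=> ab n p d x eps n0 db xb eps0.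
have := ab n p d n0 db => /=.
pose V (x y : 'I_n -> C) : R := \big[Num.max/0]_(i < n) \big[Num.max/0]_(j < n)
              cnorm (x i * y j - y j * x i)
  + \big[Num.max/0]_(j < n) `|cnorm (peval d (p j)) - cnorm (peval y (p j))|.
rewrite -/(V _ _).
set S := [set _ | _ in _].
have mx0 (F : 'I_n -> R) : 0 <= \big[Num.max/0]_(i < n) F i by apply: bigmax_ge_id.
have V0 u v : 0 <= V u v by rewrite addr_ge0.
have z0 : tuple_ball (fun=> 0 : C) (n := n) by move=> i; rewrite cn0.
have infle u v : tuple_ball v -> inf [set V u y | y in @tuple_ball R C n] <= V u v.
  move=> hv; apply: ge_inf; last by exists v.
  by exists 0 => _ [w _ <-].
(* Without an upper bound, [sup] is 0 by convention and the hypothesis would carry no information.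
   At y = 0 all commutators vanish, so V has the same value for every x. *)
have Sub : has_ubound S.
  exists (V (fun=> 0) (fun=> 0)) => _ [u _ <-].
  apply: le_trans (infle u (fun=> 0) z0) _; rewrite /V lerD2r.
  rewrite le_eqVlt; apply/orP; left; apply/eqP.
  by apply: eq_bigr => i _; apply: eq_bigr => j _; rewrite !mulr0 !mul0r.
move=> supS.
have infx : inf [set V x y | y in @tuple_ball R C n] <= 0.
  by rewrite -supS; apply: ub_le_sup => //; exists x.
have hinf : has_inf [set V x y | y in @tuple_ball R C n].
  by split; [exists (V x (fun=> 0)), (fun=> 0) | exists 0 => _ [w _ <-]].
have [_ [y yb <-] hy] := inf_adherent eps0 hinf.
have {}hy : V x y < eps by apply: lt_le_trans hy _; rewrite gerDr.
exists y; split=> // [i j|j].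
  apply: le_lt_trans hy; rewrite /V -[leLHS]addr0 lerD//.
  apply: le_trans (le_bigmax _ _ i).
  exact: (le_bigmax _ (fun j => cnorm (x i * y j - y j * x i)) j).
apply: le_lt_trans hy; rewrite /V -[leLHS]add0r lerD//.
exact: (le_bigmax _ (fun j => `|cnorm (peval d (p j)) - cnorm (peval y (p j))|) j).
Qed.
End Saturation.

(** * Homomorphisms into the commutant of a separable set *)

Section CommutingHom.
Context {R : realType}.
Local Open Scope complex_scope.
Implicit Types (C D : cstarAlgType R).

Lemma countable_enum (T : Type) (x0 : T) (Q : set T) : countable Q ->
  exists q : nat -> T, Q `<=` range q.
Proof.
move=> /countable_injP[f injf].
have /choice[q Hq] : forall n, exists x, forall y, Q y -> f y = n -> y = x.
  move=> n; have [[x [Qx fx]]|h] := pselect (exists x, Q x /\ f x = n).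
    by exists x => y Qy fy; apply: injf; rewrite ?inE// fy fx.
  by exists x0 => y Qy fy; exfalso; apply: h; exists y.
by exists q => y Qy; exists (f y) => //; apply/esym/Hq.
Qed.

(** A dense sequence is scaled into the unit ball, where types are realized; a constant factor in
    the polynomial undoes the scaling. *)
Lemma separable_generators D : separable_set [set: D] ->
  exists e : nat -> D, (forall i, cnorm (e i) <= 1) /\
    forall d eps, 0 < eps -> exists p : @starpoly R nat, cnorm (d - peval e p) < eps.
Proof.
move=> [Q cQ [_ dQ]]; have [q Hq] := countable_enum 0 cQ.
have n0 n : 0 < cnorm (q n) + 1 by have := cn_ge0 (q n); lra.
exists (fun n => ((cnorm (q n) + 1)^-1)%:C *: q n); split=> [i|d eps eps0].
  rewrite cn_realZ gtr0_norm ?invr_gt0// mulrC ler_pdivrMr// mul1r lerDl//.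
have [y Qy hy] := dQ d Logic.I _ eps0; have [n _ qn] := Hq _ Qy.
exists (PMul (PConst _ (cnorm (q n) + 1)%:C) (PVar n)) => /=.
by rewrite mulr_algl scalerA -rmorphM divff ?gt_eqF// scale1r qn.
Qed.

Lemma cauchy_inv C (x : nat -> C) :
  (forall m n, cnorm (x m - x n) <= m.+1%:R^-1 + n.+1%:R^-1) ->
  exists l : C, forall eps : R, 0 < eps -> exists N, forall n,
    (N <= n)%N -> cnorm (x n - l) < eps.
Proof.
move=> H; apply: cnorm_complete => e e0.
have [N HN] := natr_inv_small (ltac:(lra) : 0 < e / 2).
have small n : (N.+1 <= n)%N -> n.+1%:R^-1 <= e / 4.
  case: n => // n /HN; move: (n.+2%:R) => u; lra.
exists N.+1 => m n Nm Nn; apply: le_lt_trans (H m n) _.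
have := small _ Nm; have := small _ Nn; move: (m.+1%:R^-1) (n.+1%:R^-1) => u v; lra.
Qed.

Section Extension.
Context {C D : cstarAlgType R} (e : nat -> D) (y : nat -> C).
Hypothesis dense : forall d eps, 0 < eps ->
  exists p : @starpoly R nat, cnorm (d - peval e p) < eps.
Hypothesis iso : forall p, cnorm (peval y p) = cnorm (peval e p).

(* The graph of the continuous extension of [peval e p |-> peval y p]. *)
Definition closed_graph (d : D) (c : C) : Prop := forall eps, 0 < eps ->
  exists p : @starpoly R nat, cnorm (d - peval e p) <= eps /\ cnorm (c - peval y p) <= eps.

Lemma iso_dist p q : cnorm (peval y p - peval y q) = cnorm (peval e p - peval e q).
Proof.
have := iso (PAdd p (PMul (PConst _ (-1)) q)).
by rewrite /= !mulr_algl !scaleN1r.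
Qed.

Lemma closed_graph_ex d : exists c, closed_graph d c.
Proof.
have /choice[p Hp] : forall n : nat, exists p, cnorm (d - peval e p) < n.+1%:R^-1.
  by move=> n; apply: dense; rewrite invr_gt0.
have [m n|c Hc] := @cauchy_inv C (fun n => peval y (p n)).
  rewrite iso_dist; apply: (cn_dist (y := d)); last exact: ltW.
  by rewrite cnB ltW.
exists c => eps eps0; have [N HN] := Hc _ eps0.
have [M HM] := natr_inv_small eps0.
exists (p (maxn N M).+1); split; last first.
  by rewrite cnB ltW// HN// leqW// leq_maxl.
apply: le_trans (ltW (Hp _)) _.
apply: le_trans (HM (maxn N M) (leq_maxr _ _)).
by apply: ler_peMl; rewrite ?invr_ge0 ?ler1n.
Qed.

Lemma closed_graph_uniq d c c' : closed_graph d c -> closed_graph d c' -> c = c'.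
Proof.
move=> h h'; apply: cn_sub_eq0 => eps eps0; have e4 : 0 < eps / 4 by lra.
have [p [p1 p2]] := h _ e4; have [q [q1 q2]] := h' _ e4.
rewrite cnB in q2.
have pq : cnorm (peval y p - peval y q) <= eps / 4 + eps / 4.
  by rewrite iso_dist; apply: (cn_dist (y := d)); rewrite // cnB.
have := cn_dist (cn_dist p2 pq) q2; lra.
Qed.

Lemma closed_graph_peval p : closed_graph (peval e p) (peval y p).
Proof. by move=> eps eps0; exists p; rewrite !subrr !cn0 ltW. Qed.

Lemma closed_graph_lin a d d' c c' : closed_graph d c -> closed_graph d' c' ->
  closed_graph (a *: d + d') (a *: c + c').
Proof.
move=> h h' eps eps0; pose k := cabs a + 1.
have k0 : 0 < k by rewrite /k; have := cabs_ge0 a; lra.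
have e1 : 0 < eps / k by rewrite divr_gt0.
have e2 : eps / k * k = eps by rewrite divfK// gt_eqF.
have [p [p1 p2]] := h _ e1; have [q [q1 q2]] := h' _ e1.
exists (PAdd (PMul (PConst _ a) p) q) => /=.
have E : eps = cabs a * (eps / k) + eps / k by rewrite -[LHS]e2 /k; ring.
rewrite E; split; rewrite mulr_algl opprD addrACA -scalerBr;
  by apply: ler_cnD => //; rewrite cnZ ler_wpM2l ?cabs_ge0.
Qed.

Lemma closed_graph_star d c : closed_graph d c -> closed_graph (star d) (star c).
Proof.
move=> h eps eps0; have [p [p1 p2]] := h _ eps0.
by exists (PStar p); rewrite /= -!starB !cn_star.
Qed.

Lemma cn_mul_dist (A : cstarAlgType R) (a b a' b' : A) r s :
  cnorm (a - a') <= r -> cnorm (b - b') <= r -> r <= 1 -> cnorm a <= s -> cnorm b <= s ->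
  cnorm (a * b - a' * b') <= (2 * s + 1) * r.
Proof.
move=> h1 h2 r1 as_ bs.
have -> : a * b - a' * b' = a * (b - b') + (a - a') * b - (a - a') * (b - b').
  have Y : b - (b - b') = b' by rewrite opprB addrC subrK.
  by rewrite -addrA -mulrBr Y mulrBr mulrBl subrKA.
have := cn_ge0 (a - a') ; have := cn_ge0 (b - b'); have := cn_ge0 a => a0 b0 d0.
have := ler_cnB (ler_cnD (ler_cnM as_ h2) (ler_cnM h1 bs)) (ler_cnM h1 h2).
move=> /le_trans; apply; nra.
Qed.

Lemma closed_graph_mul d d' c c' : closed_graph d c -> closed_graph d' c' ->
  closed_graph (d * d') (c * c').
Proof.
move=> h h' eps eps0; pose s := cnorm d + cnorm d' + cnorm c + cnorm c'.
have := cn_ge0 d; have := cn_ge0 d'; have := cn_ge0 c; have := cn_ge0 c' => c1 c2 c3 c4.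
have s0 : 0 < 2 * s + 1 by rewrite /s; lra.
pose r := Num.min 1 (eps / (2 * s + 1)).
have r0 : 0 < r by rewrite lt_min ltr01 divr_gt0.
have r1 : r <= 1 by rewrite ge_min lexx.
have r2 : (2 * s + 1) * r <= eps by rewrite mulrC -ler_pdivlMr// ge_min lexx orbT.
have [p [p1 p2]] := h _ r0; have [q [q1 q2]] := h' _ r0.
exists (PMul p q) => /=.
by split; apply: le_trans r2; apply: cn_mul_dist => //; rewrite /s; lra.
Qed.

(** The graph is single-valued and closed under the operations, so each algebraic identity for h is
    an instance of uniqueness. *)
Lemma closed_graph_hom : exists h : D -> C, star_morph h /\ forall d, closed_graph d (h d).
Proof.
have [h Hh] := choice closed_graph_ex; exists h; split=> //.
have u d c : closed_graph d c -> h d = c.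
  by move=> g; apply: closed_graph_uniq g.
split.
- apply: u; have := closed_graph_peval (PConst _ 1).
  by rewrite /= !scale1r.
- by move=> a x z; apply: u; apply: closed_graph_lin.
- by move=> x z; apply: u; apply: closed_graph_mul.
- by move=> x; apply: u; apply: closed_graph_star.
Qed.

End Extension.

(** The two conclusions are proved together because the case [PStar] exchanges them. *)
Lemma commute_peval C (y : nat -> C) (c : C) (p : @starpoly R nat) :
  (forall i, c * y i = y i * c) -> (forall i, c * star (y i) = star (y i) * c) ->
  c * peval y p = peval y p * c /\ c * star (peval y p) = star (peval y p) * c.
Proof.
move=> h1 h2; elim: p => /= [i|a|p [p1 p2] q [q1 q2]|p [p1 p2] q [q1 q2]|p [p1 p2]].
- by [].
- by rewrite star_alg !mulr_algl !mulr_algr.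
- by rewrite starD !mulrDr !mulrDl p1 p2 q1 q2.
- by rewrite starM !mulrA p1 q2 -!mulrA q1 p2.
- by rewrite starK.
Qed.

Lemma cn_commute_lim C (a c : C) :
  (forall eps, 0 < eps -> exists c', cnorm (c - c') <= eps /\ a * c' = c' * a) ->
  a * c = c * a.
Proof.
move=> H; apply: cn_sub_eq0 => eps eps0; have a0 := cn_ge0 a.
have D0 : 0 < 2 * cnorm a + 1 by lra.
have [c' [h e]] := H _ (divr_gt0 eps0 D0).
have -> : a * c - c * a = a * (c - c') - (c - c') * a.
  by rewrite mulrBr mulrBl e opprB addrA subrK.
set r := _ / _ in h.
have : r * (2 * cnorm a + 1) = eps by rewrite divfK// gt_eqF.
have := ler_cnB (ler_cnM (lexx (cnorm a)) h) (ler_cnM h (lexx (cnorm a))).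
have : 0 < r by rewrite divr_gt0.
move=> r0 h1 h2; apply: le_trans h1 _; lra.
Qed.

Definition comm_condition C (A : set C) (a : set_type A) (i : nat) :
    @starpoly R (set_type A + nat) :=
  PAdd (PMul (PVar (inl a)) (PVar (inr i)))
    (PMul (PConst _ (-1)) (PMul (PVar (inr i)) (PVar (inl a)))).

Lemma peval_comm_condition C (A : set C) a i (b : nat -> C) :
  peval (param_val b) (@comm_condition C A a i) = val a * b i - b i * val a.
Proof. by rewrite /= mulr_algl scaleN1r. Qed.

Lemma exists_commuting_hom C D (S : set C) :
  countably_saturated [set: C] -> potentially_absorbing D C ->
  separable_set [set: D] -> separable_set S ->
  exists h : D -> C, star_morph h /\ forall d s, S s -> s * h d = h d * s.
Proof.
move=> sat ab sepD sepS.
have [e [e1 dense]] := separable_generators sepD.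
(* Adjoints of S are included so that s commutes also with each [star (y i)]. *)
pose A := S `|` (@star R C) @` S.
have sepA : separable_set A.
  apply: separable_setU => //; apply: separable_image => // x y.
  by rewrite -starB cn_star.
pose I := ((set_type A * nat) + @starpoly R nat)%type.
pose p (i : I) := match i with
  | inl ak => comm_condition ak.1 ak.2
  | inr q => psubst (fun k => PVar (inr k)) q end.
pose r (i : I) := match i with inl _ => 0 | inr q => cnorm (peval e q) end.
have pq (b : nat -> C) q : peval (param_val b) (p (inr q)) = peval b q.
  by rewrite /p peval_psubst.
have [n g eps eps0|y [y1 Hy]] := @saturation_poly R C A I p r sat sepA.
  pose bd k := match g k with inl ak => maxn ak.2.+1 n.+1 | inr q => maxn (pbound q) n.+1 end.
  (* Absorption uses one number for the polynomials, the variables and the elements to commute with;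
     m exceeds n and all variable indices in the chosen conditions. *)
  pose m := (\max_(k < n) bd k + n.+1)%N.
  have bdm k : (bd k <= m)%N by apply: leq_trans (leq_bigmax k) (leq_addr _ _).
  have nm : (n < m)%N by rewrite /m leq_addl.
  have m0 : (0 < m)%N by apply: leq_ltn_trans nm.
  (* Dividing by s brings the parameters into the unit ball; the precision eps / s compensates for
     it. *)
  pose s := 1 + \sum_(k < n) (match g k with inl ak => cnorm (val ak.1) | inr _ => 0 end).
  have gs k a i : g k = inl (a, i) -> cnorm (val a) <= s.
    move=> gk; rewrite /s (bigD1 k)//= gk /=.
    rewrite addrCA lerDl addr_ge0// sumr_ge0// => j _; case: (g j) => // ak; exact: cn_ge0.
  have s1 : 1 <= s.
    by rewrite /s lerDl sumr_ge0// => k _; case: (g k) => // ak; exact: cn_ge0.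
  have s0 : 0 < s by apply: lt_le_trans s1.
  (* Condition k occupies slot k, as a polynomial or as an element to commute with; the other slots
     are filled with 0. *)
  pose pp (j : 'I_m) : @starpoly R 'I_m := match insub (val j) : option 'I_n with
    | Some k => match g k with inl _ => PConst _ 0 | inr q => truncate m q end
    | None => PConst _ 0 end.
  pose xx (j : 'I_m) : C := match insub (val j) : option 'I_n with
    | Some k => match g k with inl ak => (s^-1)%:C *: val ak.1 | inr _ => 0 end
    | None => 0 end.
  have xb : tuple_ball xx.
    move=> j; rewrite /xx; case: insub => [k|]; last by rewrite cn0.
    case gk : (g k) => [[a i]|q]; last by rewrite cn0.
    rewrite cn_realZ ger0_norm ?invr_ge0 ?(ltW s0)//= mulrC ler_pdivrMr// mul1r.
    exact: gs gk.
  have e's : 0 < eps / s by rewrite divr_gt0.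
  have [y [yb yc yn]] := absorbing_approx ab pp m0 (fun j : 'I_m => e1 j) xb e's.
  exists (fun i => if insub i is Some j then y j else 0); split=> [i|k].
    by case: insub => [j|]; rewrite ?cn0//; apply: yb.
  have km : (k < m)%N by apply: ltn_trans nm.
  have insk : insub (val (Ordinal km)) = Some k :> option 'I_n.
    exact: (valK k).
  case gk : (g k) => [[a i]|q].
    rewrite /p peval_comm_condition /r subr0 ger0_norm ?cn_ge0//.
    have im : (i < m)%N.
      by apply: leq_trans (bdm k); rewrite /bd gk /= leq_maxl.
    rewrite insubT.
    have := yc (Ordinal km) (Ordinal im); rewrite /xx insk gk /=.
    rewrite -scalerAl -scalerAr -scalerBr cn_realZ gtr0_norm ?invr_gt0//.
    by rewrite mulrC ltr_pM2r ?invr_gt0.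
  have qm : (pbound q <= m)%N.
    by apply: leq_trans (bdm k); rewrite /bd gk /= leq_maxl.
  rewrite pq /r -(@peval_truncate _ _ m _ y _ qm); last first.
    by move=> j; rewrite valK.
  have := yn (Ordinal km); rewrite /pp insk gk.
  rewrite (@peval_truncate _ _ m e _ _ qm)// distrC => /lt_le_trans; apply.
  by rewrite ler_pdivrMr// ler_peMr// ltW.
have iso q : cnorm (peval y q) = cnorm (peval e q) by have := Hy (inr q); rewrite pq.
have comA a i : A a -> a * y i = y i * a.
  move=> Aa; have := Hy (inl (mk_set_type Aa, i)).
  rewrite /p peval_comm_condition /r => /eqP.
  by rewrite cn_eq0 subr_eq0 => /eqP.
have [h [hm gr]] := closed_graph_hom dense iso.
exists h; split=> // d s Ss; apply: cn_commute_lim => eps /(gr d)[q [_ hq]].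
exists (peval y q); split=> //.
apply: (commute_peval q _ _).1 => i; first by apply: comA; left.
have : star s * y i = y i * star s by apply: comA; right; exists s.
by move=> /(congr1 (@star _ _)); rewrite !starM starK.
Qed.

End CommutingHom.
(** * Conjugation into the relative commutant *)

Section Conjugation.
Context {R : realType}.
Local Open Scope complex_scope.
Implicit Types (C D : cstarAlgType R).

Lemma peval_morph C (A : cstarAlgType R) (h : A -> C) (X : Type) (v : X -> A) p :
  star_morph h -> peval (h \o v) p = h (peval v p).
Proof.
move=> hm; elim: p => /= [x|a|p -> q ->|p -> q ->|p ->].
- by [].
- by rewrite (smorph_alg hm).
- by rewrite (smorphD hm).
- by rewrite (star_morphM hm).
- by rewrite (star_morph_star hm).
Qed.

Section Inner.
Context {C : cstarAlgType R}.
Implicit Types (v : C).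

(** In this direction, a v with v f = h v carries the commutant of the range of h into that of the
    range of f. *)
Definition conj_by v (c : C) := star v * c * v.

Lemma conj_by_morph v : unitary v -> star_morph (conj_by v).
Proof.
move=> [v1 v2]; split=> [|a x y|x y|x]; rewrite /conj_by.
- by rewrite mulr1.
- by rewrite mulrDr mulrDl -scalerAr -scalerAl.
- by rewrite !mulrA -(mulrA _ v (star v)) v2 mulr1.
- by rewrite !starM starK mulrA.
Qed.

Lemma unitary_star v : unitary v -> unitary (star v).
Proof. by move=> [v1 v2]; split; rewrite starK. Qed.

Lemma conj_byK v : unitary v -> cancel (conj_by (star v)) (conj_by v).
Proof.
move=> [v1 v2] c; rewrite /conj_by starK !mulrA v1 mul1r -mulrA v1 mulr1 //.
Qed.

Lemma conj_byVK v : unitary v -> cancel (conj_by v) (conj_by (star v)).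
Proof. by move=> /unitary_star/conj_byK; rewrite starK. Qed.

Lemma conj_by_cn v c : unitary v -> cnorm (conj_by v c) = cnorm c.
Proof.
move=> hv; apply/eqP; rewrite eq_le (smorph_cn (conj_by_morph hv))/=.
rewrite -{1}(conj_byVK hv c).
exact: smorph_cn (conj_by_morph (unitary_star hv)) _.
Qed.

Lemma conj_by_fix v c : unitary v -> v * c = c * v -> conj_by v c = c.
Proof. by move=> [v1 _] e; rewrite /conj_by -mulrA -e mulrA v1 mul1r. Qed.

Lemma upd_comp (h : C -> C) (b : nat -> C) k x : upd (h \o b) k (h x) = h \o upd b k x.
Proof. by apply/funext => i; rewrite /upd /=; case: eqP. Qed.

(** Conjugation is an isometric automorphism permuting the unit ball, so quantifiers range over the
    same values. *)
Lemma interp_conj v (P : Type) (par : P -> C) (phi : formula P) (b : nat -> C) :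
  unitary v ->
  interp [set: C] (conj_by v \o par) phi (conj_by v \o b) = interp [set: C] par phi b.
Proof.
move=> hv; have im (F G : C -> R) : (forall x, F (conj_by v x) = G x) ->
    [set F x | x in ball1 [set: C]] = [set G x | x in ball1 [set: C]].
  move=> FG; apply/seteqP; split=> _ [x [_ /= x1] <-].
    exists (conj_by (star v) x); last by rewrite -FG conj_byK.
    by split=> //=; rewrite conj_by_cn//; apply: unitary_star.
  by exists (conj_by v x); rewrite ?FG//; split=> //=; rewrite conj_by_cn.
elim: phi b => [p|n f fc phis IH|k psi IH|k psi IH] b /=.
- rewrite -[RHS](conj_by_cn _ hv) -(peval_morph _ _ (conj_by_morph hv)); congr cnorm.
  by apply: eq_peval => -[].
- by congr f; apply/rowP => i; rewrite !mxE IH.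
- by congr sup; apply: im => x; rewrite upd_comp IH.
- by congr inf; apply: im => x; rewrite upd_comp IH.
Qed.
End Inner.

(** * Exact conjugation by saturation, and the relative commutant *)

Section UnitaryConj.
Context {C D : cstarAlgType R}.
Hypotheses (sat : countably_saturated [set: C]) (half_flip : approx_inner_half_flip D).
Hypothesis sepD : separable_set [set: D].

Lemma separable_hom_range (f : D -> C) : star_morph f -> separable_set (range f).
Proof.
by move=> hf; apply: separable_image => // x y; rewrite -(smorphB hf) (smorph_cn hf).
Qed.

(** The conditions on the single variable x_0 are approximately satisfied by [tsum f h w], and those
    concerning B hold there exactly. *)
Lemma commuting_homs_conj (f h : D -> C) (B : set C) :
  star_morph f -> star_morph h -> (forall d e, f d * h e = h e * f d) ->
  separable_set B ->
  (forall b, B b -> forall d, f d * b = b * f d /\ h d * b = b * h d) ->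
  exists v, [/\ unitary v, forall d, v * f d = h d * v & forall b, B b -> v * b = b * v].
Proof.
move=> hf hh fcom sepB comB.
pose A := (range f `|` range h) `|` B.
have sepA : separable_set A.
  by apply: separable_setU => //; apply: separable_setU; apply: separable_hom_range.
have Af d : A (f d) by left; left; exists d.
have Ah d : A (h d) by left; right; exists d.
have AB b : B b -> A b by right.
pose I := (bool + (D + set_type B))%type.
pose V : @starpoly R (set_type A + nat) := PVar (inr 0%N).
pose sub p q : @starpoly R (set_type A + nat) := PAdd p (PMul (PConst _ (-1)) q).
pose par a (Aa : A a) : @starpoly R (set_type A + nat) := PVar (inl (mk_set_type Aa)).
pose p (i : I) := match i with
  | inl true => sub (PMul (PStar V) V) (PConst _ 1)
  | inl false => sub (PMul V (PStar V)) (PConst _ 1)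
  | inr (inl d) => sub (PMul V (par _ (Af d))) (PMul (par _ (Ah d)) V)
  | inr (inr b) => sub (PMul V (par _ (AB _ (set_valP b)))) (PMul (par _ (AB _ (set_valP b))) V)
  end.
have pE (b : nat -> C) : [/\
    peval (param_val b) (p (inl true)) = star (b 0%N) * b 0%N - 1,
    peval (param_val b) (p (inl false)) = b 0%N * star (b 0%N) - 1,
    forall d, peval (param_val b) (p (inr (inl d))) = b 0%N * f d - h d * b 0%N
  & forall c, peval (param_val b) (p (inr (inr c))) = b 0%N * val c - val c * b 0%N].
  by split=> [||d|c] /=; rewrite mulr_algl scaleN1r ?scale1r.
have [n g eps eps0|b [_ Hb]] := @saturation_poly R C A I p (fun=> 0) sat sepA.
  pose ds := [seq (match g k with inr (inl d) => d | _ => 0 end) | k <- enum 'I_n].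
  have eps2 : 0 < eps / 2 by lra.
  have [w [w1 w2 w3 w4]] := commuting_pair_approx half_flip hf hh fcom ds eps2.
  exists (fun=> tsum f h w); split=> // k; rewrite subr0 ger0_norm ?cn_ge0//.
  have [p1 p2 p3 p4] := pE (fun=> tsum f h w).
  suff : cnorm (peval (param_val (fun=> tsum f h w)) (p (g k))) <= eps / 2 by lra.
  case gk : (g k) => [[]|[d|c]].
  - by rewrite p1.
  - by rewrite p2.
  - by rewrite p3; apply: w4; apply/mapP; exists k; rewrite ?mem_enum// gk.
  - rewrite p4; suff -> : tsum f h w * val c = val c * tsum f h w.
      by rewrite subrr cn0 ltW.
    rewrite /tsum mulr_suml mulr_sumr; apply: eq_bigr => a _.
    have Bc : B (val c) := set_valP c.
    by rewrite -mulrA (comB _ Bc _).2 !mulrA (comB _ Bc _).1.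
have zero i : peval (param_val b) (p i) = 0 by apply: cnorm_eq0; apply: Hb.
have [p1 p2 p3 p4] := pE b.
exists (b 0%N); split.
- by split; apply/eqP; rewrite -subr_eq0; apply/eqP; [rewrite -p1|rewrite -p2].
- by move=> d; apply/eqP; rewrite -subr_eq0 -p3 zero.
- move=> c Bc; apply/eqP; rewrite -subr_eq0.
  by have := zero (inr (inr (mk_set_type Bc))); rewrite p4 => ->.
Qed.

Hypothesis absorb : potentially_absorbing D C.

Lemma homs_unitarily_conjugate (f g : D -> C) : star_morph f -> star_morph g ->
  exists u : C, unitary u /\ forall d, g d = u * f d * star u.
Proof.
move=> hf hg.
have sepS : separable_set (range f `|` range g).
  by apply: separable_setU; apply: separable_hom_range.
have [h [hh hS]] := exists_commuting_hom sat absorb sepD sepS.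
have sep0 : separable_set (set0 : set C) by apply: separable_countable.
have [|//|v [[v1 v2] vf _]] := @commuting_homs_conj f h set0 hf hh _ sep0.
  by move=> d e; apply: hS; left; exists d.
have [|//|w [[w1 w2] wg _]] := @commuting_homs_conj g h set0 hg hh _ sep0.
  by move=> d e; apply: hS; right; exists d.
(* f and g need not commute with each other; both are conjugate to h, by v and w respectively. *)
exists (star w * v); split.
  split; rewrite starM starK !mulrA.
    by rewrite -(mulrA (star v)) w2 mulr1.
  by rewrite -(mulrA (star w)) v2 mulr1.
move=> d; rewrite starM starK !mulrA -(mulrA (star w) v) vf !mulrA.
by rewrite -(mulrA _ v) v2 mulr1 -mulrA -wg mulrA w1 mul1r.
Qed.

Lemma conj_into_commutant (f : D -> C) (S B : set C) : star_morph f ->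
  separable_set S -> separable_set B -> B `<=` rel_commutant f ->
  exists v, [/\ unitary v, forall b, B b -> conj_by v b = b &
    forall s, S s -> rel_commutant f (conj_by v s)].
Proof.
move=> hf sepS sepB Bf.
have sepA : separable_set ((S `|` B) `|` range f).
  by apply: separable_setU; [apply: separable_setU|apply: separable_hom_range].
have [h [hh hA]] := exists_commuting_hom sat absorb sepD sepA.
have [||v [hv vf vB]] := @commuting_homs_conj f h B hf hh _ sepB.
- by move=> d e; apply: hA; right; exists d.
- move=> b Bb d; split; first exact: Bf.
  by rewrite hA//; left; right.
have fv d : f d * star v = star v * h d.
  have [v1 v2] := hv.
  rewrite -[LHS]mul1r -v1 -!mulrA; congr (_ * _).
  by rewrite mulrA vf -mulrA v2 mulr1.
exists v; split=> // [b Bb|s Ss d].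
  by apply: conj_by_fix => //; apply: vB.
rewrite /conj_by !mulrA fv -(mulrA (star v)) -hA; last by left; left.
by rewrite !mulrA -!mulrA vf.
Qed.

Lemma interp_commutant (f : D -> C) (P : Type) (par : P -> C) (phi : formula P)
    (b : nat -> C) :
  star_morph f -> separable_set (range par) -> (forall x, rel_commutant f (par x)) ->
  (forall i, rel_commutant f (b i)) ->
  interp (rel_commutant f) par phi b = interp [set: C] par phi b.
Proof.
move=> hf sepP parf.
(* The sets of values coincide, not merely their bounds, so equality of [sup] and [inf] needs no
   boundedness of formulas. The element v fixes the parameters and all countably many values of c,
   and moves only x. *)
have values psi k (c : nat -> C) : (forall i, rel_commutant f (c i)) ->
    (forall a : nat -> C, (forall i, rel_commutant f (a i)) ->
      interp (rel_commutant f) par psi a = interp [set: C] par psi a) ->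
    [set interp (rel_commutant f) par psi (upd c k x) | x in ball1 (rel_commutant f)] =
    [set interp [set: C] par psi (upd c k x) | x in ball1 [set: C]].
  move=> cf IH; have updf x : rel_commutant f x -> forall i, rel_commutant f (upd c k x i).
    by move=> fx i; rewrite /upd; case: eqP.
  apply/seteqP; split=> _ [x [xf /= x1] <-].
    by exists x => //; rewrite IH//; apply: updf.
  have sepx : separable_set [set x] by apply: separable_countable; apply: finite_set_countable.
  have sepB : separable_set (range par `|` range c).
    by apply: separable_setU => //; apply: separable_range_seq.
  have [|v [hv vB vx]] := conj_into_commutant hf sepx sepB.
    by move=> _ [[z _ <-]|[i _ <-]].
  have {}vx := vx x erefl.
  exists (conj_by v x); first by split=> //=; rewrite conj_by_cn.
  rewrite IH; last exact: updf.
  have {1}<- : conj_by v \o par = par.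
    by apply/funext => z; apply: vB; left; exists z.
  have {1}<- : conj_by v \o c = c.
    by apply/funext => i; apply: vB; right; exists i.
  by rewrite upd_comp interp_conj.
elim: phi b => [p|n F Fc phis IH|k psi IH|k psi IH] b bf //=.
- by congr F; apply/rowP => i; rewrite !mxE IH.
- by rewrite values.
- by rewrite values.
Qed.

Lemma commutant_subalgebra (f : D -> C) : star_morph f -> cstar_subalgebra (rel_commutant f).
Proof.
move=> hf; split=> [d|a x y fx fy d|x y fx fy d|x fx d|x fx d].
- by rewrite mulr1 mul1r.
- by rewrite mulrDr mulrDl -scalerAr -scalerAl fx fy.
- by rewrite mulrA fx -!mulrA fy.
- by have /(congr1 (@star _ _)) := fx (star d);
    rewrite !starM (star_morph_star hf) starK.
- apply: cn_commute_lim => eps /fx[y fy xy]; exists y; split; first exact: ltW.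
  exact: fy.
Qed.

Lemma commutant_saturated (f : D -> C) : star_morph f ->
  countably_saturated (rel_commutant f).
Proof.
move=> hf A Af sepA Sigma fin.
have sepv : separable_set (range (val : set_type A -> C)).
  suff -> : range (val : set_type A -> C) = A by [].
  apply/seteqP; split=> [_ [a _ <-]|a Aa]; first exact: set_valP.
  by exists (mk_set_type Aa).
have valf (a : set_type A) : rel_commutant f (val a) by apply: Af; apply: set_valP.
have [|S0 finS0 subS0 eps /(fin S0 finS0 subS0)[b [hb Hb]]|b [hb Hb]] :=
    sat _ sepA (Sigma := Sigma) => //.
  exists b; split=> [i|phi S0phi]; first by split=> //; case: (hb i).
  rewrite -(interp_commutant _ hf sepv valf); first exact: Hb.
  by move=> i; case: (hb i).
(* A single v moves the whole sequence b, so the joint type of the realization is preserved. *)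
have [v [hv vA vb]] := conj_into_commutant hf (separable_range_seq b) sepA Af.
have vbi i : rel_commutant f (conj_by v (b i)) by apply: vb; exists i.
exists (conj_by v \o b); split=> [i|phi Sphi].
  by split=> //=; rewrite conj_by_cn//; case: (hb i).
rewrite (interp_commutant _ hf sepv valf vbi).
have {1}<- : conj_by v \o (val : set_type A -> C) = val.
  by apply/funext => a /=; apply: vA; apply: set_valP.
by rewrite interp_conj// Hb.
Qed.

End UnitaryConj.
End Conjugation.

Theorem theorem2 (R : realType) (C D : cstarAlgType R)
    (D_separable : separable_set [set: D])
    (D_half_flip : approx_inner_half_flip D)
    (C_saturated : countably_saturated [set: C])
    (C_absorbing : potentially_absorbing D C) :
  [/\ forall f g : {lrmorphism D -> C}, star_hom f -> star_hom g ->
        exists u : C, unitary u /\ forall d, g d = u * f d * star u,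
      forall f : {lrmorphism D -> C}, star_hom f -> injective f ->
        elementary_submodel (rel_commutant f)
    & forall f : {lrmorphism D -> C}, star_hom f -> injective f ->
        countably_saturated (rel_commutant f)].
Proof.
split=> [f g /star_hom_morph hf /star_hom_morph hg|f /star_hom_morph hf _|f /star_hom_morph hf _].
- exact: homs_unitarily_conjugate.
- split=> [|phi a af]; first exact: commutant_subalgebra.
  apply: interp_commutant => //.
  by apply: separable_countable; rewrite (_ : range _ = set0)//; apply/seteqP; split=> // _ [[]].
- exact: commutant_saturated.
Qed.
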